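(* Let $1<p<\infty$, let $\Gamma$ be a countably infinite set, and let $w:\Gamma\to\{2^n:n\in\mathbb{Z}\}$ be a modified weight function on $\Gamma$. For $n\in\mathbb{Z}$ let $\Gamma_n=\{\gamma\in\Gamma: w(\gamma)=2^n\}$. Then (1) $\ell^{p,\infty}(\Gamma,w)$ is isomorphic to $\ell^{p,\infty}$ if and only if $\sup_n|\Gamma_n|=\infty$; (2) $\ell^{p,\infty}(\Gamma,w)$ is isomorphic to $\ell^\infty$ if and only if $\sup_n|\Gamma_n|<\infty$.
   Context: For a set $\Gamma$ and $w:\Gamma\to(0,\infty)$, $\ell^{p,\infty}(\Gamma,w)$ is the space of all $x:\Gamma\to\mathbb{R}$ with $\|x\|=\sup_{c>0}c\,(\mu\{|x|>c\})^{1/p}<\infty$, where $\mu(A)=\sum_{\gamma\in A}w(\gamma)$ for $A\subseteq\Gamma$. This expression is equivalent to a norm under which the space is a Banach space. A modified weight function is a weight function with values in $\{2^n:n\in\mathbb{Z}\}$. $\ell^{p,\infty}$ is $\ell^{p,\infty}(\mathbb{N},w)$ with $w\equiv1$; $\ell^\infty$ is the space of bounded real sequences. ''Isomorphic'' means linearly homeomorphic. $|A|$ denotes the cardinality of $A$ (here $|\Gamma_n|$ may be infinite, in which case the supremum is $\infty$). *)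

(* Defs.v *)
From HB Require Import structures.
From mathcomp Require Import all_boot all_order all_algebra.
From mathcomp Require Import all_classical all_reals all_analysis.
From mathcomp Require Import ring.

Set Implicit Arguments.
Unset Strict Implicit.
Unset Printing Implicit Defensive.

Import Order.TTheory GRing.Theory Num.Theory.
Import numFieldNormedType.Exports.

Local Open Scope classical_set_scope.
Local Open Scope ring_scope.

Definition isomorphic (R : realType) (X Y : preTopologicalLmodType R) : Prop :=
  exists (f : {linear X -> Y}) (g : Y -> X),
    [/\ cancel f g, cancel g f, continuous f & continuous g].

(* Extended-valued: the associated space consists of the functions at which
   the quasi-norm is finite. The convention 0 * +oo = 0 makes homogeneity
   meaningful at infinite values. *)
Record quasinorm (R : realType) (I : Type) := Quasinorm {
  qnorm :> (I -> R) -> \bar R ;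
  qnorm_ge0 : forall x, (0 <= qnorm x)%E ;
  qnorm_eq0 : forall x, qnorm x = 0%E -> x = 0 ;
  qnormZ : forall (a : R) (x : I -> R), qnorm (a *: x) = (`|a|%:E * qnorm x)%E ;
  qnormD : exists2 K : R, 0 < K &
    forall x y : I -> R, (qnorm (x + y)%R <= K%:E * (qnorm x + qnorm y))%E
}.

Section QuasinormSpace.
Context {R : realType} {I : Type} (N : quasinorm R I).

Definition qfinite : {pred I -> R} := [pred x | (N x < +oo)%E].

Record qspace := QSpace { qval :> I -> R ; qvalP : qval \in qfinite }.

HB.instance Definition _ := [isSub for qval].
HB.instance Definition _ := [Choice of qspace by <:].

Lemma qnorm0 : N 0 = 0%E.
Proof. by rewrite -(scale0r (0 : I -> R)) qnormZ normr0 mul0e. Qed.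

Lemma qnormN x : N (- x) = N x.
Proof. by rewrite -scaleN1r qnormZ normrN1 mul1e. Qed.

Lemma qfinite_submod_closed : submod_closed qfinite.
Proof.
split; first by rewrite inE qnorm0 ltry.
move=> a x y; rewrite !inE => Nx Ny.
have [K K0 NK] := qnormD N.
apply: (le_lt_trans (NK _ _)); rewrite qnormZ.
apply: lte_mul_pinfty; rewrite ?lee_fin ?ltW//.
by rewrite lte_add_pinfty// lte_mul_pinfty// lee_fin.
Qed.

HB.instance Definition _ := GRing.isSubmodClosed.Build _ _ qfinite
  qfinite_submod_closed.
HB.instance Definition _ := [SubChoice_isSubLmodule of qspace by <:].

(* A quasi-ball need not be open, but quasi-balls form a base of
   neighbourhoods. *)
Definition qball (x : qspace) (e : R) : set qspace :=
  [set y | (N (qval (y - x)%R) < e%:E)%E].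

Definition qnbhs (x : qspace) : set_system qspace :=
  filter_from [set e : R | 0 < e] (qball x).

HB.instance Definition _ := hasNbhs.Build qspace qnbhs.

Lemma qball_center (x : qspace) (e : R) : 0 < e -> qball x e x.
Proof. by move=> e0; rewrite /qball/= subrr qnorm0 lte_fin. Qed.

Lemma qnbhs_filter (x : qspace) : ProperFilter (qnbhs x).
Proof.
apply: filter_from_proper; last by move=> e e0; exists x; exact: qball_center.
apply: filter_from_filter; first by exists 1; exact: ltr01.
move=> d e /= d0 e0; exists (Num.min d e); first by rewrite /= lt_min d0.
move=> y; rewrite /qball/= => yde.
by split; apply: (lt_le_trans yde); rewrite lee_fin ge_min lexx ?orbT.
Qed.

Lemma qnbhs_singleton (x : qspace) (A : set qspace) : qnbhs x A -> A x.
Proof. by case=> e e0; apply; exact: qball_center. Qed.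

Lemma qnbhs_nbhs (x : qspace) (A : set qspace) :
  qnbhs x A -> qnbhs x (qnbhs^~ A).
Proof.
case=> e /= e0 xeA; have [K K0 NK] := qnormD N.
have d0 : 0 < e / (2 * K) by rewrite divr_gt0// mulr_gt0.
exists (e / (2 * K)) => // y xy; exists (e / (2 * K)) => // z yz.
apply: xeA; rewrite /qball /mkset in xy yz *.
have -> : z - x = (z - y) + (y - x) by rewrite addrA subrK.
rewrite [qval _]/(qval (z - y) + qval (y - x)).
apply: (le_lt_trans (NK _ _)).
have -> : e = K * (e / (2 * K) + e / (2 * K)).
  by field; rewrite gt_eqF.
by rewrite EFinM EFinD lte_pmul2l ?lte_fin// lteD.
Qed.

HB.instance Definition _ := Nbhs_isNbhsTopological.Build qspace
  qnbhs_filter qnbhs_singleton qnbhs_nbhs.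

End QuasinormSpace.

Section WeakLp.
Local Open Scope ereal_scope.
Context {R : realType} {G : choiceType}.
Implicit Types (w : G -> {posnum R}) (p : R) (x y : G -> R).

Definition wmeasure w (A : set G) : \bar R := \esum_(g in A) ((w g)%:num)%:E.

(* +oo `^ p^-1 = +oo, so a level set of infinite mass gives an infinite
   quasi-norm. *)
Definition weak_norm p w x : \bar R :=
  ereal_sup [set c%:E * (wmeasure w [set g | (c < `|x g|)%R]) `^ p^-1
            | c in [set c : R | (0 < c)%R]].

Lemma wmeasure_ge0 w A : 0 <= wmeasure w A.
Proof. by apply: esum_ge0 => g _; rewrite lee_fin. Qed.

Lemma le_wmeasure w A B : A `<=` B -> wmeasure w A <= wmeasure w B.
Proof.
move=> AB; rewrite /wmeasure !(esum_mkcond _ (fun g => ((w g)%:num)%:E)).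
apply: le_esum => g _; case: ifPn => [|_]; last by case: ifP.
by move/set_mem/AB/mem_set => ->.
Qed.

Lemma wmeasureU w A B :
  wmeasure w (A `|` B) <= wmeasure w A + wmeasure w B.
Proof.
rewrite /wmeasure !(esum_mkcond _ (fun g => ((w g)%:num)%:E)).
rewrite -esumD; last 2 first.
- by move=> g _; case: ifP.
- by move=> g _; case: ifP.
apply: le_esum => g _; rewrite in_setU.
by case: (g \in A); case: (g \in B) => //=; rewrite ?adde0 ?add0e// leeDl.
Qed.

Lemma wmeasure_eq0 w A : wmeasure w A = 0 -> A = set0.
Proof.
move=> wA; rewrite -subset0 => g Ag.
have : wmeasure w [set g] <= wmeasure w A by apply: le_wmeasure => _ ->.
by rewrite wA /wmeasure esum_set1// leNgt lte_fin gt0.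
Qed.

Lemma le_weak_norm p w x (c : R) : (0 < c)%R ->
  c%:E * (wmeasure w [set g | (c < `|x g|)%R]) `^ p^-1 <= weak_norm p w x.
Proof. by move=> c0; apply: ereal_sup_ubound; exists c. Qed.

Lemma weak_norm_ge0 p w x : 0 <= weak_norm p w x.
Proof.
apply: le_trans (le_weak_norm p w x ltr01).
by rewrite mule_ge0// poweR_ge0.
Qed.

Section Quasinorm.
Variables (p : R) (p1 : (1 < p)%R) (w : G -> {posnum R}).

Let pV_gt0 : (0 < p^-1)%R.
Proof. by rewrite invr_gt0 (lt_trans ltr01). Qed.

Lemma weak_norm0 : weak_norm p w 0%R = 0.
Proof.
apply/eqP; rewrite eq_le weak_norm_ge0 andbT.
apply: ge_ereal_sup => _ [c /= c0 <-].
rewrite (_ : [set g | _] = set0); last first.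
  by rewrite -subset0 => g /=; rewrite normr0 ltNge (ltW c0).
by rewrite /wmeasure esum_set0 poweR0r ?mule0// gt_eqF.
Qed.

Lemma weak_norm_eq0 x : weak_norm p w x = 0 -> x = 0%R.
Proof.
move=> Nx; apply/funext => g; apply/eqP; apply: contraT => xg0.
have c0 : (0 < `|x g| / 2)%R by rewrite divr_gt0// normr_gt0.
have := le_weak_norm p w x c0; rewrite Nx => le0.
have : wmeasure w [set h | (`|x g| / 2 < `|x h|)%R] `^ p^-1 = 0.
  apply/eqP; rewrite eq_le poweR_ge0 andbT.
  by move: le0; rewrite pmule_rle0// lte_fin.
move/(poweR_eq0_eq0 (wmeasure_ge0 _ _))/wmeasure_eq0/seteqP => [+ _].
by move=> /(_ g)/=; case; rewrite ltr_pdivrMr// ltr_pMr ?normr_gt0// ltr1n.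
Qed.

Lemma weak_normZ (a : R) x :
  weak_norm p w (a *: x)%R = `|a|%:E * weak_norm p w x.
Proof.
have [->|a0] := eqVneq a 0%R.
  by rewrite scale0r weak_norm0 normr0 mul0e.
have na0 : (0 < `|a|)%R by rewrite normr_gt0.
rewrite /weak_norm -ereal_sup_pZl//; congr ereal_sup.
apply/seteqP; split => [_ [c /= c0 <-]|_ [_ [c /= c0 <-] <-]].
  exists ((c / `|a|)%:E * wmeasure w [set g | (c / `|a| < `|x g|)%R] `^ p^-1).
    by exists (c / `|a|)%R => //=; rewrite divr_gt0.
  rewrite muleA -EFinM mulrCA divff ?gt_eqF// mulr1.
  congr (_ * wmeasure w _ `^ _); apply/seteqP; split=> g /=;
    by rewrite normrM ltr_pdivrMr// mulrC.
exists (`|a| * c)%R => /=; first by rewrite mulr_gt0.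
rewrite EFinM -muleA; congr (_ * (_ * wmeasure w _ `^ _)).
by apply/seteqP; split=> g /=; rewrite normrM ltr_pM2l.
Qed.

Let poweR_le2 (a b : \bar R) : 0 <= a -> 0 <= b ->
  (a + b) `^ p^-1 <= 2%:E * (a `^ p^-1 + b `^ p^-1).
Proof.
move=> a0 b0; wlog ab : a b a0 b0 / a <= b.
  move=> H; have [/H|/ltW/H] := leP a b; first exact.
  by rewrite addeC [X in _ * X]addeC; exact.
have : (a + b) `^ p^-1 <= (2%:E * b) `^ p^-1.
  apply: gt0_ler_poweR; rewrite ?in_itv/= ?leey ?andbT ?adde_ge0 ?mule_ge0//.
    exact: ltW.
  by rewrite mule_natl mule2n leeD2r.
move=> /le_trans; apply; rewrite poweRM//.
apply: lee_pmul; rewrite ?poweR_ge0//; last by rewrite leeDr// poweR_ge0.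
rewrite poweR_EFin lee_fin -[leRHS]powRr1//.
by rewrite ler_powR ?ler1n// invf_le1 ?ltW// (lt_trans ltr01).
Qed.

Lemma weak_normD : exists2 K : R, (0 < K)%R & forall x y,
  weak_norm p w (x + y)%R <= K%:E * (weak_norm p w x + weak_norm p w y).
Proof.
exists 4%R => // x y; apply: ge_ereal_sup => _ [c /= c0 <-].
have c20 : (0 < c / 2)%R by rewrite divr_gt0.
pose S (z : G -> R) := wmeasure w [set g | (c / 2 < `|z g|)%R].
have leS : wmeasure w [set g | (c < `|(x + y)%R g|)%R] <= S x + S y.
  apply: le_trans (wmeasureU _ _ _); apply: le_wmeasure => g /= cxy.
  have [xc|] := leP `|x g|%R (c / 2)%R; last by left.
  have [yc|] := leP `|y g|%R (c / 2)%R; last by right.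
  move: cxy; rewrite ltNge => /negP; case.
  by rewrite (le_trans (ler_normD _ _))// [leRHS](splitr c) lerD.
have Sge0 z : 0 <= S z by exact: wmeasure_ge0.
apply: (@le_trans _ _ (c%:E * (2%:E * (S x `^ p^-1 + S y `^ p^-1)))).
  rewrite lee_pmul2l ?lte_fin//; apply: le_trans (poweR_le2 _ _) => //.
  apply: gt0_ler_poweR; rewrite ?in_itv/= ?leey ?andbT ?adde_ge0//.
    exact: ltW.
  exact: wmeasure_ge0.
have -> : c%:E * (2%:E * (S x `^ p^-1 + S y `^ p^-1)) =
    4%:E * ((c / 2)%:E * S x `^ p^-1 + (c / 2)%:E * S y `^ p^-1).
  rewrite -ge0_muleDr ?poweR_ge0// !muleA -!EFinM; congr (_%:E * _).
  by rewrite mulrCA; congr (_ * _)%R; rewrite -[4%R]/((2 * 2)%:R)%R natrM mulfK.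
by rewrite lee_pmul2l ?lte_fin// leeD// le_weak_norm.
Qed.

Definition weak_quasinorm : quasinorm R G :=
  Quasinorm (weak_norm_ge0 p w) weak_norm_eq0 weak_normZ weak_normD.

Definition weaklp := qspace weak_quasinorm.

End Quasinorm.
End WeakLp.

Definition weaklp_nat (R : realType) (p : R) (p1 : 1 < p) :=
  weaklp p1 (fun _ : nat => 1%:pos).

Section Linfty.
Context {R : realType}.
Local Open Scope ereal_scope.
Implicit Types x y : nat -> R.

Definition sup_norm x : \bar R := ereal_sup (range (fun n => `|x n|%:E)).

Lemma le_sup_norm x n : `|x n|%:E <= sup_norm x.
Proof. by apply: ereal_sup_ubound; exists n. Qed.

Lemma sup_norm_ge0 x : 0 <= sup_norm x.
Proof. by apply: le_trans (le_sup_norm x 0); rewrite lee_fin. Qed.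

Lemma sup_norm_eq0 x : sup_norm x = 0 -> x = 0%R.
Proof.
move=> x0; apply/funext => n; apply/eqP; rewrite -normr_le0 -lee_fin.
by rewrite (le_trans (le_sup_norm x n))// x0.
Qed.

Lemma sup_normZ (a : R) x : sup_norm (a *: x)%R = `|a|%:E * sup_norm x.
Proof.
have [->|a0] := eqVneq a 0%R.
  rewrite scale0r normr0 mul0e; apply/eqP; rewrite eq_le sup_norm_ge0 andbT.
  by apply: ge_ereal_sup => _ [n _ <-]; rewrite normr0.
rewrite /sup_norm -ereal_sup_pZl ?normr_gt0//; congr ereal_sup.
rewrite image_comp; apply: eq_imagel => n _ /=.
by rewrite normrM EFinM.
Qed.

Lemma sup_normD : exists2 K : R, (0 < K)%R &
  forall x y, sup_norm (x + y)%R <= K%:E * (sup_norm x + sup_norm y).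
Proof.
exists 1%R => // x y; rewrite mul1e; apply: ge_ereal_sup => _ [n _ <-].
by rewrite (@le_trans _ _ (`|x n|%:E + `|y n|%:E))//
  ?leeD ?le_sup_norm// -EFinD lee_fin ler_normD.
Qed.

Lemma sup_norm_bounded x : (sup_norm x < +oo) <-> bounded_fun x.
Proof.
have setT_proper : ProperFilter (globally [set: nat]).
  exact: (@globally_properfilter _ _ 0%N).
split=> [xoo|/ex_bound[M xM]].
  have Nfin : sup_norm x \is a fin_num by rewrite ge0_fin_numE// sup_norm_ge0.
  apply/ex_bound; exists (fine (sup_norm x)) => n _.
  by rewrite /= -lee_fin fineK// le_sup_norm.
apply: (@le_lt_trans _ _ M%:E); last exact: ltry.
by apply: ge_ereal_sup => _ [n _ <-]; rewrite lee_fin; exact: xM.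
Qed.

Definition sup_quasinorm : quasinorm R nat :=
  Quasinorm sup_norm_ge0 sup_norm_eq0 sup_normZ sup_normD.

End Linfty.

Definition linfty (R : realType) := qspace (@sup_quasinorm R).

Definition level (R : realType) (G : Type) (w : G -> {posnum R}) (n : int) :
  set G := [set g | (w g)%:num = 2 ^ n].

(* Main.v *)
From HB Require Import structures.
Require Import Defs.
From mathcomp Require Import all_boot all_order all_algebra.
From mathcomp Require Import all_classical all_reals all_analysis.
From mathcomp Require Import ring lra.

Set Implicit Arguments.
Unset Strict Implicit.
Unset Printing Implicit Defensive.

Import Order.TTheory GRing.Theory Num.Theory.
Import numFieldNormedType.Exports.

Local Open Scope classical_set_scope.
Local Open Scope ring_scope.

(** Write [theta] for [1 - p^-1], [L] for the space [l^{p,oo}] over the natural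
    numbers, [X] for the weighted space over [G], and [Y] for the sum
    [(L + L + ...)_oo] of countably many copies of [L] with the supremum of the
    norms.

    If each power of two is the weight of at most [N] points, a function of
    modulus [w `^ (- p^-1)] exceeds [c] only where [w] is below [c `^ (- p)], and
    such points have total mass at most [2 * N * c `^ (- p)] because the sum of
    distinct powers of two is at most twice the largest. Hence the weak norm of
    [x] is equivalent to the supremum of [|x| * w `^ p^-1], and [X] is isomorphic
    to [l^oo] ([qiso_linfty]).

    If the levels are unbounded, [X] and [L] are both isomorphic to [Y], by the
    decomposition method ([decomposition]): two spaces each complemented in the
    other are isomorphic as soon as one of them is isomorphic to its own
    countable [l^oo]-sum. The two complementations rest on one principle
    ([qcompl_of_limit]): since balls are closed under coordinatewise limits, a
    uniformly bounded sequence of approximate left inverses can be replaced by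
    its limit along an ultrafilter.
    - [X] is complemented in [Y] ([qcompl_approx]): at scale [n] a point of weight
      [w g] is replaced by about [n * w g] points of weight one, up to
      rescaling. The left inverse averages over these points; averaging is
      bounded because a weakly bounded function has sum at most of order
      [n `^ theta] over [n] points ([weak_norm_sum]), which uses [1 < p].
    - [Y] is complemented in [X] ([qcompl_rich]) when all levels are finite: for
      all [m] and [n], the first [n] coordinates of the [m]-th copy of [L] are
      placed on [n] points of a common weight [2 ^ K], with the intervals
      [[K, K + n]] pairwise disjoint. Blocks so separated do not interact, and
      letting [n] grow recovers the whole of each copy.
    - If some level is infinite, then [L] is a coordinate subspace of [X], and
      [Y] is complemented in the space of weights [2 ^ m], each taken infinitely
      often, which is itself complemented in [L] by averaging over blocks of
      [2 ^ m] integers ([qcompl_grid]).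

    The two cases exclude each other because [L] is not complemented in [l^oo]
    ([ones_not_compl_linfty]). Indeed, let [u_i] in [l^oo] be the images of the
    unit vectors [e_i]. The norm of a signed sum of [n] unit vectors is
    [n `^ p^-1], so at each coordinate only boundedly many [u_i] exceed a given
    [delta]. Cutting [u_i] off below [delta] gives [v_i] whose signed sums are
    bounded uniformly, while the image of [v_i] in [L] still has [i]-th
    coordinate at least [1/2]. For a suitable choice of signs the image of the
    signed sum of [n] of them has [n] coordinates whose moduli add up to at
    least [n / 2] ([signs]), whereas this sum is at most of order
    [n `^ theta].

    Throughout, maps are handled as operators on functions, bounded with respect
    to the extended quasi-norms; [isomorphicP] translates this into the
    topological notion of isomorphism. *)

(** * Bounded linear maps between quasi-normed function spaces *)

Section BoundedMaps.
Context {R : realType}.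

(** Maps are total on functions, but linear only on the finite ones, so that
   a limit along an ultrafilter, meaningful for bounded sequences only,
   qualifies. *)
Definition qlinear I J (N1 : quasinorm R I) (f : (I -> R) -> (J -> R)) :=
  forall (a : R) x y, x \in qfinite N1 -> y \in qfinite N1 ->
    f (a *: x + y) = a *: f x + f y.

Definition qbounded I J (N1 : quasinorm R I) (N2 : quasinorm R J) (C : R)
    (f : (I -> R) -> (J -> R)) :=
  forall x (M : R), (N1 x <= M%:E)%E -> (N2 (f x) <= (C * M)%:E)%E.

Definition blinear I J (N1 : quasinorm R I) (N2 : quasinorm R J) f :=
  qlinear N1 f /\ exists2 C, 0 <= C & qbounded N1 N2 C f.

Definition qiso I J (N1 : quasinorm R I) (N2 : quasinorm R J) :=
  exists f g, [/\ blinear N1 N2 f, blinear N2 N1 g,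
    {in qfinite N1, cancel f g} & {in qfinite N2, cancel g f}].

(** The identity of the first space factors through the second: the first is
   isomorphic to the range of the bounded projection [f \o g]. *)
Definition qcompl I J (N1 : quasinorm R I) (N2 : quasinorm R J) :=
  exists f g, [/\ blinear N1 N2 f, blinear N2 N1 g &
    {in qfinite N1, cancel f g}].

Lemma qfiniteP I (N : quasinorm R I) x :
  reflect (exists2 M : R, 0 <= M & (N x <= M%:E)%E) (x \in qfinite N).
Proof.
rewrite inE; apply: (iffP idP) => [Nx|[M _ NM]]; last first.
  exact: le_lt_trans NM (ltry _).
have Nf : N x \is a fin_num by rewrite ge0_fin_numE// qnorm_ge0.
by exists (fine (N x)); rewrite ?fine_ge0 ?qnorm_ge0// fineK.
Qed.

Lemma qnorm_le_ge0 I (N : quasinorm R I) x (M : R) :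
  (N x <= M%:E)%E -> 0 <= M.
Proof. by move=> /(le_trans (qnorm_ge0 N x)); rewrite lee_fin. Qed.

Lemma blinear_fin I J (N1 : quasinorm R I) (N2 : quasinorm R J) f x :
  blinear N1 N2 f -> x \in qfinite N1 -> f x \in qfinite N2.
Proof.
move=> [_ [C C0 fC]] /qfiniteP[M M0 xM]; apply/qfiniteP; exists (C * M).
  exact: mulr_ge0.
exact: fC.
Qed.

Lemma qlinear0 I J (N1 : quasinorm R I) (f : (I -> R) -> (J -> R)) :
  qlinear N1 f -> f 0 = 0.
Proof.
move=> lf; have N0 : (0 : I -> R) \in qfinite N1 by exact: rpred0.
have := lf (-1) _ _ N0 N0.
by rewrite scaler0 addr0 scaleN1r addNr.
Qed.

Lemma qlinearD I J (N1 : quasinorm R I) (f : (I -> R) -> (J -> R)) x y :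
  qlinear N1 f -> x \in qfinite N1 -> y \in qfinite N1 ->
  f (x + y) = f x + f y.
Proof. by move=> lf x1 y1; have := lf 1 _ _ x1 y1; rewrite !scale1r. Qed.

Lemma qlinearZ I J (N1 : quasinorm R I) (f : (I -> R) -> (J -> R)) a x :
  qlinear N1 f -> x \in qfinite N1 -> f (a *: x) = a *: f x.
Proof.
move=> lf x1; have := lf a x 0 x1 (rpred0 _).
by rewrite (qlinear0 lf) !addr0.
Qed.

Lemma qlinearB I J (N1 : quasinorm R I) (f : (I -> R) -> (J -> R)) x y :
  qlinear N1 f -> x \in qfinite N1 -> y \in qfinite N1 ->
  f (x - y) = f x - f y.
Proof.
move=> lf x1 y1; rewrite (qlinearD lf) ?rpredN//.
by rewrite -scaleN1r (qlinearZ _ lf)// scaleN1r.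
Qed.

Lemma qlinear_sum I J (N1 : quasinorm R I) (f : (I -> R) -> (J -> R))
    (T : Type) (s : seq T) (a : T -> R) (u : T -> I -> R) :
  qlinear N1 f -> (forall t, u t \in qfinite N1) ->
  f (\sum_(t <- s) a t *: u t) = \sum_(t <- s) a t *: f (u t).
Proof.
move=> lf u1; elim: s => [|t s IH]; first by rewrite !big_nil (qlinear0 lf).
by rewrite !big_cons lf ?IH// rpred_sum// => i _; rewrite rpredZ.
Qed.

Lemma blinear_id I (N : quasinorm R I) : blinear N N id.
Proof. by split=> //; exists 1 => // x M; rewrite mul1r. Qed.

Lemma blinear_comp I J K (N1 : quasinorm R I) (N2 : quasinorm R J)
    (N3 : quasinorm R K) f g :
  blinear N1 N2 f -> blinear N2 N3 g -> blinear N1 N3 (g \o f).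
Proof.
move=> f12 g23; have [lf [C C0 fC]] := f12; have [lg [D D0 gD]] := g23.
split=> [a x y x1 y1 /=|]; first by rewrite lf// lg//; exact: blinear_fin f12 _.
exists (D * C); first exact: mulr_ge0.
by move=> x M /fC /gD; rewrite mulrA.
Qed.

Lemma blinearD I J (N1 : quasinorm R I) (N2 : quasinorm R J) f g :
  blinear N1 N2 f -> blinear N1 N2 g -> blinear N1 N2 (fun x => f x + g x).
Proof.
move=> [lf [C C0 fC]] [lg [D D0 gD]]; split=> [a x y x1 y1|].
  by rewrite lf// lg// scalerDr addrACA.
have [K K0 NK] := qnormD N2; exists (K * (C + D)).
  by rewrite mulr_ge0 ?addr_ge0// ltW.
move=> x M xM; apply: le_trans (NK _ _) _.
by rewrite -mulrA EFinM mulrDl EFinD lee_pmul2l ?lte_fin// leeD ?fC ?gD.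
Qed.

Lemma blinearN I J (N1 : quasinorm R I) (N2 : quasinorm R J) f :
  blinear N1 N2 f -> blinear N1 N2 (fun x => - f x).
Proof.
move=> [lf [C C0 fC]]; split=> [a x y x1 y1|].
  by rewrite lf// opprD scalerN.
by exists C => // x M /fC; rewrite qnormN.
Qed.

Lemma blinearB I J (N1 : quasinorm R I) (N2 : quasinorm R J) f g :
  blinear N1 N2 f -> blinear N1 N2 g -> blinear N1 N2 (fun x => f x - g x).
Proof. by move=> bf bg; apply: blinearD => //; exact: blinearN. Qed.

Lemma qiso_refl I (N : quasinorm R I) : qiso N N.
Proof. by exists id, id; split=> //; exact: blinear_id. Qed.

Lemma qiso_sym I J (N1 : quasinorm R I) (N2 : quasinorm R J) :
  qiso N1 N2 -> qiso N2 N1.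
Proof. by move=> [f [g [bf bg fg gf]]]; exists g, f. Qed.

Lemma qiso_compl I J (N1 : quasinorm R I) (N2 : quasinorm R J) :
  qiso N1 N2 -> qcompl N1 N2.
Proof. by move=> [f [g [bf bg fg gf]]]; exists f, g. Qed.

Lemma qcompl_trans I J K (N1 : quasinorm R I) (N2 : quasinorm R J)
    (N3 : quasinorm R K) : qcompl N1 N2 -> qcompl N2 N3 -> qcompl N1 N3.
Proof.
move=> [f [g [bf bg fg]]] [f' [g' [bf' bg' fg']]].
exists (f' \o f), (g \o g'); split; [exact: blinear_comp bf bf'|
  exact: blinear_comp bg' bg|] => x x1 /=.
by rewrite fg' ?fg// (blinear_fin bf).
Qed.

Lemma qiso_trans I J K (N1 : quasinorm R I) (N2 : quasinorm R J)
    (N3 : quasinorm R K) : qiso N1 N2 -> qiso N2 N3 -> qiso N1 N3.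
Proof.
move=> [f [g [bf bg fg gf]]] [f' [g' [bf' bg' fg' gf']]].
exists (f' \o f), (g \o g'); split; [exact: blinear_comp bf bf'|
  exact: blinear_comp bg' bg| |] => x x1 /=.
- by rewrite fg' ?fg// (blinear_fin bf).
- by rewrite gf ?gf'// (blinear_fin bg').
Qed.

(** A linear map continuous at the origin is bounded: rescale to the radius
   given by continuity. *)
Lemma continuous_qbounded I J (N1 : quasinorm R I) (N2 : quasinorm R J)
    (f : qspace N1 -> qspace N2) : linear f -> continuous f ->
  exists2 C : R, 0 <= C & forall x (M : R),
    (N1 (qval x) <= M%:E)%E -> (N2 (qval (f x)) <= (C * M)%:E)%E.
Proof.
move=> lf cf.
have f0 : f 0 = 0 by have := lf (-1) 0 0; rewrite scaler0 addr0 scaleN1r addNr.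
have [d /= d0 fd] : nbhs (0 : qspace N1) (f @^-1` qball 0 1).
  apply: (cf 0); exists 1 => //=; by rewrite f0.
have fZ a x : f (a *: x) = a *: f x by have := lf a x 0; rewrite f0 !addr0.
have qvZ L (N : quasinorm R L) (a : R) (x : qspace N) :
  qval (a *: x) = a *: qval x by [].
exists (2 / d); first by rewrite divr_ge0// ltW.
suff H x (M : R) : 0 < M -> (N1 (qval x) <= M%:E)%E ->
    (N2 (qval (f x)) <= (2 / d * M)%:E)%E.
  move=> x M xM; have := qnorm_le_ge0 xM.
  rewrite le_eqVlt => /predU1P[M0|M0]; last exact: H.
  have x0 : x = 0.
    apply/val_inj/(@qnorm_eq0 _ _ N1)/eqP.
    by rewrite eq_le qnorm_ge0 andbT (le_trans xM)// -M0.
  by rewrite x0 f0 -M0 mulr0 qnorm0.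
move=> M0 xM.
have c0 : 0 < d / (2 * M) by rewrite divr_gt0// mulr_gt0.
have := fd ((d / (2 * M)) *: x); rewrite /qball /= subr0 subr0 fZ !qvZ !qnormZ.
rewrite gtr0_norm// => fx.
have -> : (2 / d * M)%:E = ((d / (2 * M))^-1%:E * 1)%E.
  by rewrite mule1 invf_div mulrAC.
rewrite lee_pdivlMl//; apply/ltW/fx.
apply: (@le_lt_trans _ _ ((d / (2 * M))%:E * M%:E)%E).
  by rewrite lee_pmul2l ?lte_fin.
by rewrite -EFinM lte_fin mulrAC ltr_pdivrMr ?mulr_gt0// ltr_pM2l// ltr_pMl// ltr1n.
Qed.

Lemma qbounded_continuous I J (N1 : quasinorm R I) (N2 : quasinorm R J)
    (f : qspace N1 -> qspace N2) (C : R) : 0 <= C -> linear f ->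
  (forall x (M : R),
    (N1 (qval x) <= M%:E)%E -> (N2 (qval (f x)) <= (C * M)%:E)%E) ->
  continuous f.
Proof.
move=> C0 lf fC x A [e /= e0 eA].
have D0 : 0 < C + 1 by rewrite ltr_wpDl.
exists (e / (C + 1)) => /=; first by rewrite divr_gt0.
move=> y xy; apply: eA; rewrite /qball /mkset in xy *.
have -> : f y - f x = f (y - x).
  by rewrite [in RHS]addrC -(scaleN1r x) lf scaleN1r addrC.
apply: (le_lt_trans (fC _ _ (ltW xy))).
rewrite lte_fin mulrCA gtr_pMr// ltr_pdivrMr// mul1r ltrDl//.
Qed.

Definition restrict_fin I J (N1 : quasinorm R I) (N2 : quasinorm R J) f
    (bf : blinear N1 N2 f) (x : qspace N1) : qspace N2 :=
  QSpace (blinear_fin bf (qvalP x)).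

Lemma restrict_fin_linear I J (N1 : quasinorm R I) (N2 : quasinorm R J) f
  (bf : blinear N1 N2 f) : linear (restrict_fin bf).
Proof.
move=> a x y; apply: val_inj => /=.
by have [lf _] := bf; rewrite lf ?qvalP.
Qed.

Lemma restrict_fin_continuous I J (N1 : quasinorm R I) (N2 : quasinorm R J) f
  (bf : blinear N1 N2 f) : continuous (restrict_fin bf).
Proof.
have [_ [C C0 fC]] := bf.
by apply: (qbounded_continuous C0 (restrict_fin_linear bf)) => x M; exact: fC.
Qed.

(** The value on infinite functions is arbitrary. *)
Definition extend_fin I J (N1 : quasinorm R I) (N2 : quasinorm R J)
    (f : qspace N1 -> qspace N2) (x : I -> R) : J -> R :=
  if insub x is Some x' then qval (f x') else 0.

Lemma extend_finE I J (N1 : quasinorm R I) (N2 : quasinorm R J)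
  (f : qspace N1 -> qspace N2) (x : qspace N1) :
  extend_fin f (qval x) = qval (f x).
Proof. by rewrite /extend_fin valK. Qed.

Lemma extend_fin_blinear I J (N1 : quasinorm R I) (N2 : quasinorm R J)
    (f : qspace N1 -> qspace N2) :
  linear f -> continuous f -> blinear N1 N2 (extend_fin f).
Proof.
move=> lf cf; split.
  move=> a x y x1 y1; pose X := QSpace x1; pose Y := QSpace y1.
  rewrite -[x]/(qval X) -[y]/(qval Y).
  rewrite -[_ + _]/(qval (a *: X + Y)) !extend_finE lf//.
have [C C0 fC] := continuous_qbounded lf cf; exists C => // x M xM.
have x1 : x \in qfinite N1.
  by apply/qfiniteP; exists M => //; exact: qnorm_le_ge0 xM.
by rewrite -[x]/(qval (QSpace x1)) extend_finE; exact: fC.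
Qed.

(** Inverses need no linearity of their own: the inverse of a linear bijection
   is linear, so continuity bounds it too. *)
Lemma isomorphicP I J (N1 : quasinorm R I) (N2 : quasinorm R J) :
  isomorphic (qspace N1) (qspace N2) <-> qiso N1 N2.
Proof.
split=> [[f [g [fg gf cf cg]]]|[f [g [bf bg fg gf]]]].
  have lg : linear g.
    by move=> a x y; apply: (can_inj fg); rewrite gf linearP !gf.
  exists (extend_fin f), (extend_fin g); split.
  - by apply: extend_fin_blinear => //; exact: linearP.
  - exact: extend_fin_blinear.
  - by move=> x x1; rewrite -[x]/(qval (QSpace x1)) !extend_finE fg.
  - by move=> x x1; rewrite -[x]/(qval (QSpace x1)) !extend_finE gf.
pose F : {linear qspace N1 -> qspace N2} := HB.pack (restrict_fin bf)
  (GRing.isLinear.Build _ _ _ _ (restrict_fin bf) (restrict_fin_linear bf)).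
exists F, (restrict_fin bg); split.
- by move=> x; apply: val_inj; rewrite /= fg ?qvalP.
- by move=> x; apply: val_inj; rewrite /= gf ?qvalP.
- exact: restrict_fin_continuous.
- exact: restrict_fin_continuous.
Qed.

End BoundedMaps.

(** * Direct sums and the decomposition method *)

Section DirectSums.
Context {R : realType}.

Lemma setT_bij (A B : Type) : ([set: A] #= [set: B])%card ->
  exists (h : A -> B) (k : B -> A), cancel h k /\ cancel k h.
Proof.
move=> /card_bijP[h [k hk kh]].
exists (fun a => val (h (SigSub (mem_setT a)))).
exists (fun b => val (k (SigSub (mem_setT b)))); split=> [a|b].
- by rewrite (_ : SigSub _ = h (SigSub (mem_setT a))) ?hk//; exact: val_inj.
- by rewrite (_ : SigSub _ = k (SigSub (mem_setT b))) ?kh//; exact: val_inj.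
Qed.

Definition pairf I J (x : I -> R) (y : J -> R) (s : I + J) : R :=
  match s with inl i => x i | inr j => y j end.
Definition fstf I J (z : I + J -> R) : I -> R := z \o inl.
Definition sndf I J (z : I + J -> R) : J -> R := z \o inr.

Lemma pairf_fst_snd I J (z : I + J -> R) : pairf (fstf z) (sndf z) = z.
Proof. by apply/funext => -[]. Qed.

Section Product.
Context {I J : Type} (N1 : quasinorm R I) (N2 : quasinorm R J).
Local Open Scope ereal_scope.

Definition prod_norm (z : I + J -> R) : \bar R :=
  Order.max (N1 (fstf z)) (N2 (sndf z)).

Lemma prod_norm_ge0 z : 0 <= prod_norm z.
Proof. by rewrite le_max qnorm_ge0. Qed.

Lemma prod_norm_eq0 z : prod_norm z = 0 -> z = 0%R.
Proof.
move=> z0; have := lexx (prod_norm z); rewrite [leRHS]z0 ge_max => /andP[z1 z2].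
have f0 : fstf z = 0%R.
  by apply: (@qnorm_eq0 _ _ N1); apply/eqP; rewrite eq_le qnorm_ge0 andbT.
have s0 : sndf z = 0%R.
  by apply: (@qnorm_eq0 _ _ N2); apply/eqP; rewrite eq_le qnorm_ge0 andbT.
by apply/funext => -[i|j]; [exact: (congr1 (@^~ i) f0)|exact: (congr1 (@^~ j) s0)].
Qed.

Lemma prod_normZ (a : R) z : prod_norm (a *: z)%R = `|a|%:E * prod_norm z.
Proof.
rewrite /prod_norm -[fstf _]/(a *: fstf z)%R -[sndf _]/(a *: sndf z)%R.
by rewrite !qnormZ maxe_pMr// lee_fin.
Qed.

Lemma prod_normD : exists2 K : R, (0 < K)%R &
  forall x y, prod_norm (x + y)%R <= K%:E * (prod_norm x + prod_norm y).
Proof.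
have [K K0 NK] := qnormD N1; have [L L0 NL] := qnormD N2.
exists (Num.max K L); first by rewrite lt_max K0.
have le1 x : N1 (fstf x) <= prod_norm x by rewrite le_max lexx.
have le2 x : N2 (sndf x) <= prod_norm x by rewrite le_max lexx orbT.
move=> x y; rewrite ge_max; apply/andP; split.
- apply: le_trans (NK _ _) _; apply: lee_pmul; rewrite ?lee_fin ?(ltW K0)//.
  + by rewrite adde_ge0// qnorm_ge0.
  + by rewrite le_max lexx.
  + exact: (leeD (le1 _) (le1 _)).
- apply: le_trans (NL _ _) _; apply: lee_pmul; rewrite ?lee_fin ?(ltW L0)//.
  + by rewrite adde_ge0// qnorm_ge0.
  + by rewrite le_max lexx orbT.
  + exact: (leeD (le2 _) (le2 _)).
Qed.

Definition prodq : quasinorm R (I + J) :=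
  Quasinorm prod_norm_ge0 prod_norm_eq0 prod_normZ prod_normD.

Lemma prodq_le z (M : R) :
  (prodq z <= M%:E) = (N1 (fstf z) <= M%:E) && (N2 (sndf z) <= M%:E).
Proof. exact: ge_max. Qed.

End Product.

Definition slice I (n : nat) (y : nat * I -> R) : I -> R := fun i => y (n, i).
Definition of_rows I (u : nat -> I -> R) : nat * I -> R := fun t => u t.1 t.2.

Lemma of_rowsK I (y : nat * I -> R) : of_rows (fun n => slice n y) = y.
Proof. by apply/funext => -[]. Qed.

Section CountableSum.
Context {I : Type} (N : quasinorm R I).
Local Open Scope ereal_scope.

Definition sum_norm (y : nat * I -> R) : \bar R :=
  ereal_sup (range (fun n => N (slice n y))).

Lemma slice_le_sum_norm n y : N (slice n y) <= sum_norm y.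
Proof. by apply: ereal_sup_ubound; exists n. Qed.

Lemma sum_norm_le y M : (forall n, N (slice n y) <= M) -> sum_norm y <= M.
Proof. by move=> H; apply: ge_ereal_sup => _ [n _ <-]. Qed.

Lemma sum_norm_ge0 y : 0 <= sum_norm y.
Proof. by apply: le_trans (slice_le_sum_norm 0 y); exact: qnorm_ge0. Qed.

Lemma sum_norm_eq0 y : sum_norm y = 0 -> y = 0%R.
Proof.
move=> y0; apply/funext => -[n i]; suff /(congr1 (@^~ i)) : slice n y = 0%R by [].
apply: (@qnorm_eq0 _ _ N); apply/eqP.
by rewrite eq_le qnorm_ge0 andbT -y0 slice_le_sum_norm.
Qed.

Lemma sum_normZ (a : R) y : sum_norm (a *: y)%R = `|a|%:E * sum_norm y.
Proof.
have [->|a0] := eqVneq a 0%R.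
  rewrite scale0r normr0 mul0e; apply/eqP; rewrite eq_le sum_norm_ge0 andbT.
  by apply: sum_norm_le => n; rewrite (_ : slice n 0%R = 0%R) ?qnorm0.
rewrite /sum_norm -ereal_sup_pZl ?normr_gt0//; congr ereal_sup.
rewrite image_comp; apply: eq_imagel => n _ /=.
by rewrite -qnormZ.
Qed.

Lemma sum_normD : exists2 K : R, (0 < K)%R &
  forall x y, sum_norm (x + y)%R <= K%:E * (sum_norm x + sum_norm y).
Proof.
have [K K0 NK] := qnormD N; exists K => // x y; apply: sum_norm_le => n.
apply: le_trans (NK _ _) _.
by rewrite lee_pmul2l ?lte_fin// leeD// slice_le_sum_norm.
Qed.

Definition supq : quasinorm R (nat * I) :=
  Quasinorm sum_norm_ge0 sum_norm_eq0 sum_normZ sum_normD.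

Lemma supq_le y (M : R) :
  (supq y <= M%:E) <-> (forall n, N (slice n y) <= M%:E).
Proof.
split=> [yM n|]; last exact: sum_norm_le.
exact: le_trans (slice_le_sum_norm n y) yM.
Qed.

End CountableSum.

Lemma fstf_blinear I J (N1 : quasinorm R I) (N2 : quasinorm R J) :
  blinear (prodq N1 N2) N1 (@fstf I J).
Proof.
by split=> //; exists 1 => // z M; rewrite prodq_le mul1r => /andP[].
Qed.

Lemma sndf_blinear I J (N1 : quasinorm R I) (N2 : quasinorm R J) :
  blinear (prodq N1 N2) N2 (@sndf I J).
Proof.
by split=> //; exists 1 => // z M; rewrite prodq_le mul1r => /andP[].
Qed.

Lemma pairf_blinear I J K (N : quasinorm R K) (N1 : quasinorm R I)
    (N2 : quasinorm R J) f g : blinear N N1 f -> blinear N N2 g ->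
  blinear N (prodq N1 N2) (fun x => pairf (f x) (g x)).
Proof.
move=> [lf [C C0 fC]] [lg [D D0 gD]]; split=> [a x y x1 y1|].
  by rewrite lf// lg//; apply/funext => -[].
exists (Num.max C D); first by rewrite le_max C0.
move=> x M xM; have M0 := qnorm_le_ge0 xM.
rewrite prodq_le; apply/andP; split.
  by rewrite (le_trans (fC _ _ xM))// lee_fin ler_wpM2r// le_max lexx.
by rewrite (le_trans (gD _ _ xM))// lee_fin ler_wpM2r// le_max lexx orbT.
Qed.

Lemma slice_blinear I (N : quasinorm R I) n : blinear (supq N) N (slice n).
Proof. by split=> //; exists 1 => // y M /supq_le; rewrite mul1r. Qed.

Lemma map_rows_blinear I J (N1 : quasinorm R I) (N2 : quasinorm R J) f :
  blinear N1 N2 f ->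
  blinear (supq N1) (supq N2) (fun y => of_rows (fun n => f (slice n y))).
Proof.
move=> [lf [C C0 fC]]; split=> [a x y x1 y1|].
  apply/funext => -[n j]; rewrite /of_rows /= -[slice n _]/(a *: slice n x + slice n y).
  by rewrite lf//; apply: (blinear_fin (slice_blinear _ n)).
by exists C => // y M /supq_le yM; apply/supq_le => n; exact: (fC (slice n y)).
Qed.

Definition shift_rows I (y : nat * I -> R) := of_rows (fun n => slice n.+1 y).
Definition cons_slice I (z : I + nat * I -> R) :=
  of_rows (fun n => if n is m.+1 then slice m (sndf z) else fstf z).

Lemma shift_rows_blinear I (N : quasinorm R I) :
  blinear (supq N) (supq N) (@shift_rows I).
Proof.
split=> //; exists 1 => // y M /supq_le yM.
by rewrite mul1r; apply/supq_le => n; exact: (yM n.+1).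
Qed.

Lemma cons_slice_blinear I (N : quasinorm R I) :
  blinear (prodq N (supq N)) (supq N) (@cons_slice I).
Proof.
split=> [a x y _ _|]; first by apply/funext => -[[|n] i].
exists 1 => // z M; rewrite prodq_le mul1r => /andP[z1 /supq_le z2].
by apply/supq_le => -[|n]; [exact: z1|exact: (z2 n)].
Qed.

Lemma qcompl_supq I J (N1 : quasinorm R I) (N2 : quasinorm R J) :
  qcompl N1 N2 -> qcompl (supq N1) (supq N2).
Proof.
move=> [f [g [bf bg fg]]].
exists (fun y => of_rows (fun n => f (slice n y))).
exists (fun y => of_rows (fun n => g (slice n y))).
split; [exact: map_rows_blinear|exact: map_rows_blinear|] => y y1.
rewrite -[RHS]of_rowsK; congr of_rows; apply/funext => n.
by rewrite -[slice n _]/(f (slice n y)) fg// (blinear_fin (slice_blinear _ n)).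
Qed.

Lemma qiso_prodC I J (N1 : quasinorm R I) (N2 : quasinorm R J) :
  qiso (prodq N1 N2) (prodq N2 N1).
Proof.
exists (fun z => pairf (sndf z) (fstf z)), (fun z => pairf (sndf z) (fstf z)).
split; try by apply: pairf_blinear; [exact: sndf_blinear|exact: fstf_blinear].
- by move=> z _; rewrite -[RHS]pairf_fst_snd.
- by move=> z _; rewrite -[RHS]pairf_fst_snd.
Qed.

Lemma qiso_prodr I J K (N : quasinorm R K) (N1 : quasinorm R I)
    (N2 : quasinorm R J) : qiso N1 N2 -> qiso (prodq N N1) (prodq N N2).
Proof.
move=> [f [g [bf bg fg gf]]].
exists (fun z => pairf (fstf z) (f (sndf z))).
exists (fun z => pairf (fstf z) (g (sndf z))); split.
- apply: pairf_blinear; first exact: fstf_blinear.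
  exact: blinear_comp (sndf_blinear _ _) bf.
- apply: pairf_blinear; first exact: fstf_blinear.
  exact: blinear_comp (sndf_blinear _ _) bg.
- move=> z z1; rewrite -[RHS]pairf_fst_snd; congr pairf.
  by rewrite -[sndf _]/(f (sndf z)) fg// (blinear_fin (sndf_blinear N _)).
- move=> z z1; rewrite -[RHS]pairf_fst_snd; congr pairf.
  by rewrite -[sndf _]/(g (sndf z)) gf// (blinear_fin (sndf_blinear N _)).
Qed.

Lemma qiso_supq_supq I (N : quasinorm R I) : qiso (supq (supq N)) (supq N).
Proof.
have [h [k [hk kh]]] := setT_bij card_nat2.
exists (fun y t => y ((k t.1).1, ((k t.1).2, t.2))).
exists (fun y t => y (h (t.1, t.2.1), t.2.2)); split.
- split=> //; exists 1 => // y M /supq_le yM; rewrite mul1r; apply/supq_le => n.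
  have /supq_le yMn := yM (k n).1; exact: (yMn (k n).2).
- split=> //; exists 1 => // y M /supq_le yM; rewrite mul1r.
  by apply/supq_le => a; apply/supq_le => b; exact: (yM (h (a, b))).
- by move=> y _; apply/funext => -[a [b i]] /=; rewrite hk.
- by move=> y _; apply/funext => -[n i] /=; rewrite -surjective_pairing kh.
Qed.

(** If [V] splits as [N + M], then [l^oo(V)] absorbs one more copy of [N], by
   moving the [N]-parts of the terms one step: [(v_n)] goes to the [N]-part of
   [v_0] followed by the sequence whose term [n] has the [M]-part of [v_n] and
   the [N]-part of [v_n.+1]. The projections onto the summands are [f \o g]
   and its complement. *)
Lemma supq_absorb I J (N : quasinorm R I) (V : quasinorm R J) :
  qcompl N V -> qiso (supq V) (prodq N (supq V)).
Proof.
move=> [f [g [bf bg fg]]].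
have bP : blinear V V (f \o g) by exact: blinear_comp bg bf.
have bQ : blinear V V (fun v => v - f (g v)).
  by apply: blinearB => //; exact: blinear_id.
have [[lf _] [lg _]] := (bf, bg).
have gfin v : v \in qfinite V -> g v \in qfinite N by exact: blinear_fin.
have ffin v : v \in qfinite N -> f v \in qfinite V by exact: blinear_fin.
have rfin n y : y \in qfinite (supq V) -> slice n y \in qfinite V.
  exact: (blinear_fin (slice_blinear _ n)).
have gQ v : v \in qfinite V -> g (v - f (g v)) = 0.
  by move=> vf; rewrite (qlinearB lg) ?fg ?subrr ?gfin// ffin ?gfin.
pose F y := pairf (g (slice 0 y))
  (of_rows (fun n => slice n y - f (g (slice n y))) +
   of_rows (fun n => (f \o g) (slice n (shift_rows y)))).
pose G z := of_rows (fun n => slice n (sndf z) - f (g (slice n (sndf z)))) +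
  cons_slice (pairf (f (fstf z)) (of_rows (fun n => (f \o g) (slice n (sndf z))))).
have FE n y : slice n (sndf (F y)) = (slice n y - f (g (slice n y))) + f (g (slice n.+1 y)).
  by [].
have G0 z : slice 0 (G z) = (slice 0 (sndf z) - f (g (slice 0 (sndf z)))) + f (fstf z).
  by [].
have GS n z : slice n.+1 (G z) = (slice n.+1 (sndf z) - f (g (slice n.+1 (sndf z)))) +
    f (g (slice n (sndf z))) by [].
have PfinP u v : u \in qfinite V -> v \in qfinite V ->
    (u - f (g u) + f (g v) \in qfinite V) * (g (u - f (g u) + f (g v)) = g v).
  move=> uf vf; split; first by rewrite rpredD ?rpredB ?ffin ?gfin.
  by rewrite (qlinearD lg) ?gQ ?add0r ?fg ?gfin// ?rpredB ?ffin ?gfin.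
exists F, G; split.
- apply: pairf_blinear; first exact: blinear_comp (slice_blinear _ _) bg.
  apply: blinearD; first exact: map_rows_blinear bQ.
  exact: (blinear_comp (shift_rows_blinear V) (map_rows_blinear bP)).
- apply: blinearD.
    exact: (blinear_comp (sndf_blinear _ _) (map_rows_blinear bQ)).
  apply: (blinear_comp (g := @cons_slice _)); last exact: cons_slice_blinear.
  apply: pairf_blinear; first exact: blinear_comp (fstf_blinear _ _) bf.
  exact: (blinear_comp (sndf_blinear _ _) (map_rows_blinear bP)).
- move=> y y1; rewrite -[RHS]of_rowsK -[LHS]of_rowsK; congr of_rows.
  apply/funext => -[|n].
    rewrite G0 FE !PfinP ?rfin//.
    by rewrite -[fstf (F y)]/(g (slice 0 y)) addrK subrK.
  by rewrite GS !FE !PfinP ?rfin// addrK subrK.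
- move=> z z1.
  have zf : fstf z \in qfinite N by exact: (blinear_fin (fstf_blinear _ _) z1).
  have zn n : slice n (sndf z) \in qfinite V.
    exact/rfin/(blinear_fin (sndf_blinear _ _) z1).
  have gG0 : g (slice 0 (G z)) = fstf z.
    by rewrite G0 (qlinearD lg) ?gQ ?add0r ?fg ?ffin// rpredB ?ffin ?gfin.
  rewrite -[RHS]pairf_fst_snd -[LHS]pairf_fst_snd; congr pairf; first exact: gG0.
  rewrite -[RHS]of_rowsK -[LHS]of_rowsK; congr of_rows; apply/funext => n.
  rewrite FE GS PfinP// (_ : slice n (G z) - _ = slice n (sndf z) - f (g (slice n (sndf z)))).
    by rewrite subrK.
  case: n => [|n]; first by rewrite gG0 G0 addrK.
  by rewrite GS PfinP// addrK.
Qed.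

(** The summand of [X] complementary to [Y] is left alone while [Y] absorbs
   [Z]. *)
Lemma compl_absorb I J K (X : quasinorm R I) (Y : quasinorm R J)
    (Z : quasinorm R K) :
  qcompl Y X -> qiso Y (prodq Z Y) -> qiso X (prodq Z X).
Proof.
move=> [f [g [bf bg fg]]] [a [b [ba bb ab ba']]].
have bQ : blinear X X (fun x => x - f (g x)).
  by apply: blinearB; [exact: blinear_id|exact: blinear_comp bg bf].
have [[lf _] [lg _]] := (bf, bg).
have gfin v : v \in qfinite X -> g v \in qfinite Y by exact: blinear_fin.
have ffin v : v \in qfinite Y -> f v \in qfinite X by exact: blinear_fin.
have gQ v : v \in qfinite X -> g (v - f (g v)) = 0.
  by move=> vf; rewrite (qlinearB lg) ?fg ?subrr ?gfin// ffin ?gfin.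
have gQD u v : u \in qfinite Y -> v \in qfinite X -> g (f u + (v - f (g v))) = u.
  by move=> uf vf; rewrite (qlinearD lg) ?gQ ?fg ?addr0 ?ffin// rpredB ?ffin ?gfin.
pose F x := pairf (fstf (a (g x))) (f (sndf (a (g x))) + (x - f (g x))).
pose h (z : K + I -> R) := pairf (fstf z) (g (sndf z)).
pose m z := b (h z).
pose G z := f (m z) + (sndf z - f (g (sndf z))).
have bh : blinear (prodq Z X) (prodq Z Y) h.
  apply: pairf_blinear; first exact: fstf_blinear.
  exact: blinear_comp (sndf_blinear _ _) bg.
have bm : blinear (prodq Z X) Y m by exact: blinear_comp bh bb.
exists F, G; split.
- have bag : blinear X (prodq Z Y) (a \o g) by exact: blinear_comp bg ba.
  apply: pairf_blinear; first exact: blinear_comp bag (fstf_blinear _ _).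
  apply: blinearD => //; apply: (blinear_comp (g := f)) bf.
  exact: blinear_comp bag (sndf_blinear _ _).
- apply: blinearD; first exact: blinear_comp bm bf.
  exact: (blinear_comp (sndf_blinear _ _) bQ).
- move=> x x1; have gx := gfin _ x1.
  have agx : a (g x) \in qfinite (prodq Z Y) by exact: (blinear_fin ba gx).
  have sgx : sndf (a (g x)) \in qfinite Y by exact: (blinear_fin (sndf_blinear _ _) agx).
  have gF : g (sndf (F x)) = sndf (a (g x)) by exact: gQD.
  rewrite /G /m /h gF (_ : pairf _ _ = a (g x)) ?ab//; last exact: (pairf_fst_snd (a (g x))).
  by rewrite -[sndf (F x)]/(f (sndf (a (g x))) + (x - f (g x))) addrAC subrr add0r addrC subrK.
- move=> z z1; have mz : m z \in qfinite Y by exact: (blinear_fin bm z1).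
  have sz : sndf z \in qfinite X by exact: (blinear_fin (sndf_blinear _ _) z1).
  have gG : g (G z) = m z by exact: gQD.
  have am : a (m z) = h z by rewrite ba'//; exact: (blinear_fin bh z1).
  rewrite /F gG am -[RHS]pairf_fst_snd; congr pairf.
  rewrite -[sndf (pairf _ _)]/(g (sndf z)) /G.
  by rewrite [X in _ + X]addrAC subrr add0r addrC subrK.
Qed.

(** Pelczynski's decomposition method: with [Y] the sum of copies of [V],
   [Y] absorbs [X] and, being isomorphic to its square, [X] absorbs [Y]; so
   both are isomorphic to the product of [X] and [Y]. *)
Lemma decomposition I J (X : quasinorm R I) (V : quasinorm R J) :
  qcompl X (supq V) -> qcompl (supq V) X -> qiso X (supq V).
Proof.
move=> XY YX; set Y := supq V in XY YX *.
have YYs : qiso Y (supq Y) by exact/qiso_sym/qiso_supq_supq.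
have absorb L (Z : quasinorm R L) : qcompl Z Y -> qiso Y (prodq Z Y).
  move=> ZY; apply: (qiso_trans YYs).
  apply: (qiso_trans (supq_absorb ZY)).
  by apply: qiso_prodr; exact: qiso_sym.
have YY : qiso Y (prodq Y Y) by apply/absorb/qiso_compl/qiso_refl.
apply: (qiso_trans (compl_absorb YX YY)).
by apply: (qiso_trans (qiso_prodC _ _)); exact/qiso_sym/absorb.
Qed.

End DirectSums.

(** * The weak norm through finite sets *)

Section WeakNorm.
Context {R : realType} (p : R) (p1 : 1 < p).

Lemma exponent_gt0 : 0 < p.
Proof. exact: lt_trans p1. Qed.

Lemma pV_gt0 : 0 < p^-1.
Proof. by rewrite invr_gt0 exponent_gt0. Qed.

Lemma pV_lt1 : p^-1 < 1.
Proof. by rewrite invf_lt1// exponent_gt0. Qed.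

Lemma powRKV (a : R) : 0 <= a -> (a `^ p^-1) `^ p = a.
Proof. by move=> a0; rewrite -powRrM mulVf ?powRr1// gt_eqF// exponent_gt0. Qed.

Lemma powRVK (a : R) : 0 <= a -> (a `^ p) `^ p^-1 = a.
Proof. by move=> a0; rewrite -powRrM mulfV ?powRr1// gt_eqF// exponent_gt0. Qed.

Lemma powRV_le (a b : R) : 0 <= a -> a <= b -> a `^ p^-1 <= b `^ p^-1.
Proof.
move=> a0 ab; apply: ge0_ler_powR => //; rewrite ?nnegrE//.
  exact: (ltW pV_gt0).
exact: le_trans ab.
Qed.

Lemma powRV_leP (a b : R) : 0 <= a -> 0 <= b ->
  (a `^ p^-1 <= b) = (a <= b `^ p).
Proof.
move=> a0 b0; apply/idP/idP => [ab|ab]; last first.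
  by rewrite -[leRHS]powRVK// powRV_le.
rewrite -[leLHS]powRKV//.
by apply: ge0_ler_powR; rewrite ?nnegrE ?powR_ge0// ltW// exponent_gt0.
Qed.

Definition mass (G : choiceType) (w : G -> {posnum R}) (s : seq G) : R :=
  \sum_(g <- s) (w g)%:num.

Lemma mass_ge0 (G : choiceType) (w : G -> {posnum R}) s : 0 <= mass w s.
Proof. by apply: sumr_ge0. Qed.

Definition unit_weight (G : Type) : G -> {posnum R} := fun=> 1%:pos.

Lemma mass1 (G : choiceType) (s : seq G) :
  mass (@unit_weight G) s = (size s)%:R.
Proof. by rewrite /mass big_const_seq count_predT iter_addr_0. Qed.

(** Lets the strict level sets of the weak norm be replaced by sets on which
   the function is at least [c]. *)
Lemma ler_of_lt_factor (a c M : R) : 0 <= a -> 0 <= M ->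
  (forall c', 0 < c' -> c' < c -> c' * a <= M) -> c * a <= M.
Proof.
move=> a0 M0 H; have [c0|c0] := leP c 0; first by rewrite (le_trans _ M0)// mulr_le0_ge0.
rewrite leNgt; apply/negP => Mca.
have ap : 0 < a by rewrite lt_neqAle a0 andbT; apply: contraTneq Mca => <-; rewrite mulr0 -leNgt.
have Mc : M / a < c by rewrite ltr_pdivrMr.
have Ma0 : 0 <= M / a by rewrite divr_ge0.
have /H : 0 < (M / a + c) / 2 by lra.
have -> : (M / a + c) / 2 < c by lra.
rewrite -ler_pdivlMr// => /(_ isT); lra.
Qed.

(** The form in which the weak norm is used from here on: lower bounds on a
   finite set limit its mass. *)
Lemma weak_normP (G : choiceType) (w : G -> {posnum R}) (x : G -> R) (M : R) :
  (weak_norm p w x <= M%:E)%E <->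
  0 <= M /\ forall (s : seq G) (c : R), uniq s -> 0 <= c -> {in s, forall g, c <= `|x g|} ->
    c * mass w s `^ p^-1 <= M.
Proof.
split=> [xM|[M0 xM]].
  have M0 : 0 <= M.
    by have := le_trans (weak_norm_ge0 p w x) xM; rewrite lee_fin.
  split=> // s c us c0 cx; apply: ler_of_lt_factor; rewrite ?powR_ge0//.
  move=> c' c'0 c'c; rewrite -lee_fin (le_trans _ xM)//.
  apply: le_trans (le_weak_norm p w x c'0).
  rewrite EFinM lee_pmul2l ?lte_fin// -poweR_EFin.
  apply: gt0_ler_poweR; rewrite ?in_itv/= ?leey ?andbT ?lee_fin ?mass_ge0//.
  - exact: (ltW pV_gt0).
  - exact: wmeasure_ge0.
  apply: esum_ge; exists [set` s].
    split; first exact: finite_seq.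
    by move=> g /cx /= cg; exact: lt_le_trans cg.
  by rewrite -fsbig_seq//= sumEFin.
apply: ge_ereal_sup => _ [c /= c0 <-].
have Mc0 : 0 <= M / c by rewrite divr_ge0// ltW.
have -> : M%:E = (c%:E * ((M / c) `^ p)%:E `^ p^-1)%E.
  by rewrite poweR_EFin powRVK// -EFinM mulrC divfK// gt_eqF.
rewrite lee_pmul2l ?lte_fin//.
apply: gt0_ler_poweR; rewrite ?in_itv/= ?leey ?andbT ?lee_fin ?powR_ge0//.
- exact: (ltW pV_gt0).
- exact: wmeasure_ge0.
apply: ge_ereal_sup => _ [F [finF FA] <-].
rewrite fsbig_finite//= sumEFin lee_fin -/(mass w (finmap.enum_fset (fset_set F))).
rewrite -powRV_leP ?mass_ge0// ler_pdivlMr// mulrC; apply: xM => //.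
  exact: ltW.
move=> g; rewrite /= in_fset_set// inE => /FA; exact: ltW.
Qed.

Lemma seq_argmin d (D : orderType d) (T : eqType) (f : T -> D) (s : seq T) :
  s != [::] -> exists2 x, x \in s & {in s, forall y, (f x <= f y)%O}.
Proof.
elim: s => // x [|y s] IH _.
  by exists x; rewrite ?mem_head// => y; rewrite inE => /eqP ->.
have [//|z zs zmin] := IH; have [xz|zx] := leP (f x) (f z).
  exists x; rewrite ?mem_head// => u; rewrite inE => /predU1P[->//|/zmin].
  exact: le_trans.
exists z; first by rewrite inE zs orbT.
by move=> u; rewrite inE => /predU1P[->|/zmin//]; exact: ltW.
Qed.

(** The increment of [n `^ (1 - p^-1)] dominates its derivative at the right
   end; this is Young's inequality for [n] and [n.+1]. *)
Lemma powR_increment (n : nat) :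
  (1 - p^-1) * n.+1%:R `^ (- p^-1) + n%:R `^ (1 - p^-1)
    <= n.+1%:R `^ (1 - p^-1) :> R.
Proof.
have t0 := pV_gt0; have t1 := pV_lt1.
have q0 : 0 < 1 - p^-1 by lra.
have np0 : 0 < n.+1%:R `^ (- p^-1) :> R by rewrite powR_gt0.
have young := @conjugate_powR R (n%:R `^ (1 - p^-1)) (n.+1%:R `^ p^-1)
  (1 - p^-1)^-1 p (powR_ge0 _ _) (powR_ge0 _ _).
rewrite invr_gt0 in young.
have {young} := young q0 (exponent_gt0).
rewrite invrK subrK powRKV// -powRrM mulfV ?gt_eqF// powRr1// => /(_ erefl).
have e : n.+1%:R `^ p^-1 * n.+1%:R `^ (- p^-1) = 1 :> R.
  by rewrite powRN mulfV// gt_eqF// powR_gt0.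
have -> : n.+1%:R `^ (1 - p^-1) = n.+1%:R * n.+1%:R `^ (- p^-1) :> R.
  by rewrite powRD ?powRr1// pnatr_eq0 implybT.
have : n.+1%:R = n%:R + 1 :> R by rewrite -natr1.
set a := n.+1%:R `^ (- p^-1) in np0 e *; set A := n.+1%:R `^ p^-1 in e *.
set b := n%:R `^ _; move: a A b np0 e => a A b a0 Aa.
move: (n.+1%:R : R) (n%:R : R) (p^-1) => N m t -> young.
have /ltW := a0; move=> /ler_wpM2r /(_ _ _ young).
rewrite -mulrA Aa mulr1 -lerBrDl => /le_trans; apply.
by rewrite le_eqVlt; apply/predU1l; ring.
Qed.

(** Removing the entry of least modulus from [n] entries takes away at most
   [M / n `^ p^-1], so the sum is governed by the partial sums of
   [n `^ (- p^-1)], which are of order [n `^ (1 - p^-1)] since [1 < p]. *)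
Lemma weak_norm_sum (G : choiceType) (x : G -> R) (M : R) (s : seq G) :
  (weak_norm p (@unit_weight G) x <= M%:E)%E -> uniq s ->
  \sum_(g <- s) `|x g| <= (1 - p^-1)^-1 * M * (size s)%:R `^ (1 - p^-1).
Proof.
have t1 := pV_lt1; have q0 : 0 < 1 - p^-1 by lra.
move=> /weak_normP[M0 xM]; move: {2}(size s) (erefl (size s)) => n.
elim: n s => [|n IH] s sn us.
  by rewrite (size0nil sn) big_nil !mulr_ge0// ?powR_ge0 ?invr_ge0// ltW.
have [|g gs gmin] := @seq_argmin _ R _ (fun g => `|x g|) s.
  by rewrite -size_eq0 sn.
rewrite (perm_big _ (perm_to_rem gs)) big_cons sn.
have := IH (rem g s); rewrite size_rem// sn rem_uniq// => /(_ erefl isT) {}IH.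
have := xM s `|x g| us (normr_ge0 _) gmin; rewrite mass1 sn => xg.
have {}xg : `|x g| <= M * n.+1%:R `^ (- p^-1).
  by rewrite powRN ler_pdivlMr// powR_gt0.
apply: le_trans (lerD xg IH) _.
have := powR_increment n; rewrite -(ler_pM2l q0) => inc.
have C0 : 0 <= (1 - p^-1)^-1 * M by rewrite mulr_ge0// invr_ge0 ltW.
apply: le_trans (ler_wpM2l C0 (powR_increment n)).
by rewrite mulrDr lerD// mulrACA mulVf ?gt_eqF// mul1r.
Qed.

End WeakNorm.

(** * Limits along an ultrafilter *)

Section UltrafilterLimits.
Context {R : realType}.

Lemma ultra_bounded_cvg (U : set_system nat) (UU : UltraFilter U)
    (u : nat -> R) (M : R) :
  (forall n, `|u n| <= M) -> exists l : R, u n @[n --> U] --> l.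
Proof.
move=> uM; have UF : ProperFilter U by exact: ultra_proper.
have uUM : (u @ U) [set` `[- M, M]].
  rewrite -[(u @ U) _]/(U (u @^-1` _)).
  by apply: (filterS _ filterT) => n _; rewrite /= in_itv/= -ler_norml.
have [l [_ lcl]] := @segment_compact R (- M) M (u @ U) _ uUM.
exists l => B lB; have [//|UB] := in_ultra_setVsetC (u @^-1` B) UU.
by have [y [] ] := lcl (~` B) B UB lB.
Qed.

(** What remains of weak* compactness of the balls once the topology is that of
   coordinatewise convergence: coordinates are bounded functionals, and balls
   are closed. *)
Definition pointwise_closed I (N : quasinorm R I) :=
  (forall i, exists2 C : R, 0 <= C & forall x M, (N x <= M%:E)%E -> `|x i| <= C * M)
  /\ forall (U : set_system nat) (UF : ProperFilter U) (u : nat -> I -> R) x (M : R),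
     (forall n, (N (u n) <= M%:E)%E) -> (forall i, u n i @[n --> U] --> x i) ->
     (N x <= M%:E)%E.

Lemma pointwise_closed_supq I (N : quasinorm R I) :
  pointwise_closed N -> pointwise_closed (supq N).
Proof.
move=> [Nc NF]; split=> [[n i]|U UF u x M uM ux].
  by have [C C0 xC] := Nc i; exists C => // x M /supq_le/(_ n)/xC.
apply/supq_le => k; apply: (NF U UF (fun n => slice k (u n))) => [n|i].
  by have /supq_le := uM n; exact.
exact: ux.
Qed.

(** An identity that factors only approximately, through a sequence of
   uniformly bounded left inverses, factors exactly: take the limit of the
   left inverses along an ultrafilter. *)
Lemma qcompl_of_limit I J (N1 : quasinorm R I) (N2 : quasinorm R J)
    (f : (I -> R) -> J -> R) (g : nat -> (J -> R) -> I -> R) (C : R) :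
  pointwise_closed N1 -> blinear N1 N2 f -> 0 <= C ->
  (forall n, qlinear N2 (g n)) -> (forall n, qbounded N2 N1 C (g n)) ->
  {in qfinite N1, forall x i, \forall n \near \oo, g n (f x) i = x i} ->
  qcompl N1 N2.
Proof.
move=> [Nc NF] bf C0 lg gC gf.
have [U [UU ooU]] := @ultraFilterLemma nat \oo _.
have UF : ProperFilter U by exact: ultra_proper.
pose h y i : R := lim (g n y i @[n --> U]).
have gh y i : y \in qfinite N2 -> g n y i @[n --> U] --> h y i.
  move=> /qfiniteP[M M0 yM]; have [D D0 xD] := Nc i.
  have [|l gl] := @ultra_bounded_cvg U UU (fun n => g n y i) (D * (C * M)).
    by move=> n; apply: xD; exact: gC.
  by apply/cvg_ex; exists l.
have hE y i l : g n y i @[n --> U] --> l -> h y i = l.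
  by move=> gl; apply: (cvg_lim _ gl); exact: Rhausdorff.
exists f, h; split=> //.
- split=> [a x y x2 y2|].
    apply/funext => i; apply: hE.
    rewrite (_ : (fun n => _) = (fun n => a * g n x i + g n y i)); last first.
      by apply/funext => n; rewrite lg.
    by apply: cvgD; [apply: cvgMl_tmp; exact: gh|exact: gh].
  exists C => // y M yM; apply: (NF U UF (g^~ y)) => [n|i]; first exact: gC.
  by apply: gh; apply/qfiniteP; exists M => //; exact: qnorm_le_ge0 yM.
- move=> x x1; apply/funext => i; apply: hE.
  apply: cvg_near_cst; apply: ooU; exact: gf.
Qed.

End UltrafilterLimits.

(** * Complemented copies of weak spaces *)

Section WeakOperators.
Context {R : realType} (p : R) (p1 : 1 < p).
Local Notation W := (weak_quasinorm p1).

Lemma weak_normI (G : choiceType) (w : G -> {posnum R}) (x : G -> R) (M : R) :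
  0 <= M ->
  (forall (s : seq G) (c : R), uniq s -> 0 < c -> {in s, forall g, c <= `|x g|} ->
    c * mass w s `^ p^-1 <= M) -> (W w x <= M%:E)%E.
Proof.
move=> M0 H; apply/(weak_normP p1); split=> // s c us.
by rewrite le_eqVlt => /predU1P[<- _|]; [rewrite mul0r|exact: H].
Qed.

Lemma weak_normE (G : choiceType) (w : G -> {posnum R}) (x : G -> R) (M : R)
    (s : seq G) (c : R) : (W w x <= M%:E)%E -> uniq s -> 0 <= c ->
  {in s, forall g, c <= `|x g|} -> c * mass w s `^ p^-1 <= M.
Proof. by move=> /(weak_normP p1)[_]; exact. Qed.

Lemma weak_norm_coord (G : choiceType) (w : G -> {posnum R}) (x : G -> R) (M : R)
    g : (W w x <= M%:E)%E -> `|x g| * (w g)%:num `^ p^-1 <= M.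
Proof.
move=> xM; have := @weak_normE _ _ _ _ [:: g] `|x g| xM erefl (normr_ge0 _).
by rewrite /mass big_seq1; apply=> _ /[!inE] /eqP->.
Qed.

Lemma weak_pointwise_closed (G : choiceType) (w : G -> {posnum R}) :
  pointwise_closed (W w).
Proof.
split=> [g|U UF u x M uM ux].
  exists ((w g)%:num `^ p^-1)^-1; first by rewrite invr_ge0 powR_ge0.
  move=> x M /(@weak_norm_coord _ _ _ _ g) xg.
  by rewrite mulrC ler_pdivlMr// powR_gt0.
have M0 := qnorm_le_ge0 (uM 0%N).
apply: weak_normI => // s c us c0 cx.
apply: ler_of_lt_factor; rewrite ?powR_ge0// => c' c'0 c'c.
suff [n un] : exists n, {in s, forall g, c' <= `|u n g|}.
  exact: (weak_normE (uM n) us (ltW c'0) un).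
suff : U [set n | {in s, forall g, c' <= `|u n g|}] by exact: filter_ex.
elim: s {us} cx => [_|g s IH cx]; 
  first by apply: (@filterS _ U _ setT _ _ filterT) => n _ k; rewrite in_nil.
have : U [set n | c' < `|u n g|].
  apply: (cvgr_gt _ (cvg_norm (ux g))).
  by apply: (lt_le_trans c'c); apply: cx; rewrite mem_head.
have {}/IH : {in s, forall g, c <= `|x g|}.
  by move=> k ks; apply: cx; rewrite inE ks orbT.
apply: filterS2 => n un ug k; rewrite inE => /predU1P[->|/un//].
exact: ltW.
Qed.

(** ** Extension by zero along an injection *)

Definition extend (H G : Type) (h : H -> G) (y : H -> R) (g : G) : R :=
  if pselect (exists i, h i = g) is left e then y (projT1 (cid e)) else 0.

Lemma extend_inj (H G : Type) (h : H -> G) (y : H -> R) i :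
  injective h -> extend h y (h i) = y i.
Proof.
move=> hI; rewrite /extend; case: pselect => [e|[]]; last by exists i.
by congr y; apply: hI; exact: (projT2 (cid e)).
Qed.

Lemma extend_neq0 (H G : Type) (h : H -> G) (y : H -> R) g :
  extend h y g != 0 -> exists i, h i = g.
Proof. by rewrite /extend; case: pselect => // _; rewrite eqxx. Qed.

Lemma extend_linear (H G : Type) (h : H -> G) (a : R) (x y : H -> R) :
  extend h (a *: x + y) = a *: extend h x + extend h y.
Proof.
apply/funext => g; rewrite /extend !fctE; case: pselect => // _.
by rewrite scaler0 addr0.
Qed.

Lemma seq_preimage (H G : eqType) (h : H -> G) (s : seq G) :
  {in s, forall g, exists i, h i = g} -> exists s', s = map h s'.
Proof.
elim: s => [|g s IH] hs; first by exists [::].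
have [i hi] := hs g (mem_head _ _).
have [|s' ->] := IH; first by move=> k ks; apply: hs; rewrite inE ks orbT.
by exists (i :: s'); rewrite /= hi.
Qed.

Lemma qcompl_injection (H G : choiceType) (h : H -> G) (v : H -> {posnum R})
    (w : G -> {posnum R}) (a : R) : injective h -> 0 < a ->
  (forall i, (w (h i))%:num = a * (v i)%:num) -> qcompl (W v) (W w).
Proof.
move=> hI a0 wv; pose b := a `^ p^-1.
have b0 : 0 < b by rewrite powR_gt0.
have mh s : mass w (map h s) `^ p^-1 = b * mass v s `^ p^-1.
  rewrite -powRM ?mass_ge0 ?(ltW a0)//; congr (_ `^ _).
  by rewrite /mass big_map mulr_sumr; apply: eq_bigr => i _.
exists (fun y => b^-1 *: extend h y), (fun x i => b * x (h i)); split.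
- split=> [c x y _ _|].
    by rewrite extend_linear scalerDr !scalerA [c * _]mulrC.
  exists 1 => // y M yM; rewrite mul1r; have M0 := qnorm_le_ge0 yM.
  apply: weak_normI => // s c us c0 cy.
  have [|s' ss'] := @seq_preimage _ _ h s.
    move=> g /cy; rewrite /= => cg; apply: (@extend_neq0 _ _ _ y).
    by apply: contraTneq cg; rewrite fctE => ->; rewrite scaler0 normr0 -ltNge.
  rewrite ss' mh mulrA; apply: (weak_normE yM).
  + by move: us; rewrite ss' => /map_uniq.
  + by rewrite mulr_ge0// ltW.
  + move=> i is'; have := cy (h i); rewrite ss' map_f// fctE extend_inj//.
    move=> /(_ isT); rewrite normrM gtr0_norm ?invr_gt0// => cyi.
    by rewrite mulrC -ler_pdivlMl.
- split=> [c x y _ _|]; first by apply/funext => i; rewrite !fctE mulrDr; congr (_ + _); exact: mulrCA.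
  exists 1 => // x M xM; rewrite mul1r; have M0 := qnorm_le_ge0 xM.
  apply: weak_normI => // s c us c0 cx.
  have cb0 : 0 <= c / b by rewrite divr_ge0// ltW.
  have -> : c * mass v s `^ p^-1 = c / b * mass w (map h s) `^ p^-1.
    by rewrite mh mulrA divfK// gt_eqF.
  apply: (weak_normE xM) => //; first by rewrite map_inj_uniq.
  move=> _ /mapP[i /cx ci ->]; move: ci; rewrite normrM gtr0_norm//.
  by rewrite ler_pdivrMr// mulrC.
- move=> y _; apply/funext => i.
  by rewrite fctE extend_inj//; apply: mulVKf; rewrite gt_eqF.
Qed.

(** ** Averaging *)

(** A point of integral weight [q g] is as good as a block of [q g] points of
   weight one. *)
Definition spread (G : Type) (q : G -> nat) (x : G -> R) (t : G * nat) : R :=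
  if (t.2 < q t.1)%N then x t.1 else 0.

Definition average (G : Type) (q : G -> nat) (y : G * nat -> R) (g : G) : R :=
  (q g)%:R^-1 * \sum_(j < q g) y (g, val j).

Lemma spreadK (G : Type) (q : G -> nat) x g :
  (0 < q g)%N -> average q (spread q x) g = x g.
Proof.
move=> q0; rewrite /average (eq_bigr (fun=> x g)); last first.
  by move=> j _; rewrite /spread /= ltn_ord.
by rewrite sumr_const card_ord -[X in _ * X]mulr_natl mulKf// pnatr_eq0 -lt0n.
Qed.

Lemma spread_linear (G : Type) (q : G -> nat) a (x y : G -> R) :
  spread q (a *: x + y) = a *: spread q x + spread q y.
Proof.
apply/funext => t; rewrite /spread !fctE; case: ifP => // _.
by rewrite scaler0 addr0.
Qed.

Lemma average_linear (G : Type) (q : G -> nat) a (x y : G * nat -> R) :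
  average q (a *: x + y) = a *: average q x + average q y.
Proof.
apply/funext => g; rewrite /average !fctE.
rewrite big_split /= mulrDr; congr (_ + _).
by rewrite !mulr_sumr scaler_sumr; apply: eq_bigr => i _; exact: mulrCA.
Qed.

Lemma spread_qbounded (G : choiceType) (w : G -> {posnum R}) (q : G -> nat)
    (a : R) : 0 < a -> (forall g, (q g)%:R <= a * (w g)%:num) ->
  qbounded (W w) (W (@unit_weight R (G * nat)%type)) (a `^ p^-1) (spread q).
Proof.
move=> a0 qw x M xM; have M0 := qnorm_le_ge0 xM.
apply: weak_normI => [|s c us c0 cx]; first by rewrite mulr_ge0// powR_ge0.
have sq t : t \in s -> (t.2 < q t.1)%N.
  move=> /cx; rewrite /spread; case: ifP => // _.
  by rewrite normr0 leNgt c0.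
pose s' := undup (map fst s).
have size_s : (size s <= \sum_(g <- s') q g)%N.
  apply: (@leq_trans (size [seq (g, j) | g <- s', j <- iota 0 (q g)])).
    apply: uniq_leq_size => // -[g j] ts; apply: allpairs_f_dep.
      by rewrite mem_undup; apply/mapP; exists (g, j).
    by rewrite mem_iota add0n; exact: sq ts.
  rewrite size_allpairs_dep sumnE big_map.
  by under eq_bigr do rewrite size_iota.
rewrite mass1.
have ms : (size s)%:R <= a * mass w s'.
  apply: (@le_trans _ _ (\sum_(g <- s') q g)%:R); first by rewrite ler_nat.
  by rewrite natr_sum /mass mulr_sumr; exact: ler_sum.
apply: (@le_trans _ _ (c * (a * mass w s') `^ p^-1)).
  by rewrite ler_pM2l// powRV_le.
rewrite powRM ?mass_ge0 ?(ltW a0)// mulrCA ler_pM2l ?powR_gt0//.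
apply: (weak_normE xM (undup_uniq _) (ltW c0)) => g.
rewrite mem_undup => /mapP[t ts ->]; have := cx _ ts.
by rewrite /spread sq.
Qed.

(** A lower bound [c] for the averages over the blocks of [s] makes the sum over
   the union of these blocks at least [c] times its size, which
   [weak_norm_sum] limits. *)
Lemma average_qbounded (G : choiceType) (w : G -> {posnum R}) (q : G -> nat)
    (a : R) : 0 < a -> (forall g, (0 < q g)%N -> a * (w g)%:num <= (q g)%:R) ->
  qbounded (W (@unit_weight R (G * nat)%type)) (W w)
    ((a `^ p^-1)^-1 * (1 - p^-1)^-1) (average q).
Proof.
move=> a0 qw y M yM; have M0 := qnorm_le_ge0 yM.
have b0 : 0 < a `^ p^-1 by rewrite powR_gt0.
have d0 : 0 < 1 - p^-1 by rewrite subr_gt0 pV_lt1.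
apply: weak_normI => [|s c us c0 cy].
  by rewrite !mulr_ge0// invr_ge0 ltW.
have sq g : g \in s -> (0 < q g)%N.
  move=> /cy; rewrite /average; case: (q g) => //.
  by rewrite big_ord0 mulr0 normr0 leNgt c0.
pose s' := [seq (g, j) | g <- s, j <- iota 0 (q g)].
have us' : uniq s'.
  apply: allpairs_uniq_dep => //; first by move=> g _; exact: iota_uniq.
  by move=> [g j] [g' j'] _ _ [-> ->].
have size_s' : (size s' = \sum_(g <- s) q g)%N.
  rewrite size_allpairs_dep sumnE big_map.
  by under eq_bigr do rewrite size_iota.
have sumy : c * (size s')%:R <= \sum_(t <- s') `|y t|.
  rewrite size_s' natr_sum mulr_sumr big_allpairs_dep /=.
  rewrite big_seq [leRHS]big_seq; apply: ler_sum => g gs.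
  have := cy _ gs; rewrite /average normrM normfV normr_nat.
  rewrite ler_pdivlMl ?ltr0n ?sq// mulrC => /le_trans; apply.
  apply: le_trans (ler_norm_sum _ _ _) _.
  by rewrite -[X in iota 0 X]subn0 -/(index_iota 0 (q g)) big_mkord.
have cn : c * (size s')%:R `^ p^-1 <= (1 - p^-1)^-1 * M.
  have [->|n0] := posnP (size s').
    by rewrite powR0 ?mulr0 ?mulr_ge0// ?invr_ge0 ?ltW// gt_eqF// invr_gt0 exponent_gt0.
  have n0' : 0 < (size s')%:R :> R by rewrite ltr0n.
  rewrite -(ler_pM2r (powR_gt0 (1 - p^-1) n0')) -mulrA -powRD; last first.
    by rewrite (gt_eqF n0') implybT.
  rewrite addrC subrK powRr1 ?(ltW n0')//.
  exact: (le_trans sumy (weak_norm_sum p1 yM us')).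
have ms : a * mass w s <= (size s')%:R.
  rewrite size_s' natr_sum /mass mulr_sumr big_seq [leRHS]big_seq.
  by apply: ler_sum => g gs; rewrite qw// sq.
rewrite -mulrA ler_pdivlMl// mulrCA -powRM ?mass_ge0 ?(ltW a0)//.
by apply: le_trans cn; rewrite ler_pM2l// powRV_le// mulr_ge0 ?mass_ge0// ltW.
Qed.

End WeakOperators.

(** * Embeddings into and out of the sum of countably many copies *)

Section Embeddings.
Context {R : realType} (p : R) (p1 : 1 < p).
Local Notation W := (weak_quasinorm p1).

Lemma truncn_half (z : R) : (0 < Num.truncn z)%N -> z / 2 <= (Num.truncn z)%:R.
Proof.
rewrite truncn_gt0 => z1; have := truncnS_gt z; have z0 : 0 <= z by lra.
have : 1 <= (Num.truncn z)%:R :> R by rewrite ler1n truncn_gt0.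
rewrite -natr1; lra.
Qed.

(** At scale [n] a weight [w g] is approximated by [truncn (n * w g)] points
   of weight [n^-1]; for [n] large this loses at most a factor two, so the
   identity factors through the averages over these points in the limit. *)
Lemma qcompl_approx (G : choiceType) (w : G -> {posnum R}) :
  qcompl (W w) (supq (W (@unit_weight R (G * nat)%type))).
Proof.
pose q n g := Num.truncn (n.+1%:R * (w g)%:num).
pose b n : R := n.+1%:R `^ p^-1.
have b0 n : 0 < b n by rewrite powR_gt0.
have d0 : 0 < 1 - p^-1 by rewrite subr_gt0 pV_lt1.
pose f x := of_rows (fun n => (b n)^-1 *: spread (q n) x).
pose g n y := b n *: average (q n) (slice n y) : G -> R.
pose C := (2^-1 `^ p^-1)^-1 * (1 - p^-1)^-1.
apply: (@qcompl_of_limit _ _ _ _ _ f g C).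
- exact: weak_pointwise_closed.
- split=> [a x y _ _|].
    apply/funext => -[n t]; rewrite /f /of_rows /= spread_linear.
    by rewrite scalerDr scalerA mulrC -scalerA.
  exists 1 => // x M xM; rewrite mul1r; apply/supq_le => n.
  rewrite -[slice n _]/((b n)^-1 *: spread (q n) x) qnormZ.
  rewrite gtr0_norm ?invr_gt0// lee_pdivrMl// -EFinM.
  apply: (spread_qbounded (a := n.+1%:R) _ _ xM) => // k.
  by rewrite /q truncn_le mulr_ge0.
- by rewrite mulr_ge0// invr_ge0 ?powR_ge0 ?ltW.
- move=> n a x y _ _; rewrite /g -[slice n _]/(a *: slice n x + slice n y).
  by rewrite average_linear scalerDr !scalerA [b n * _]mulrC.
- move=> n y M /supq_le/(_ n) yM; rewrite /g qnormZ gtr0_norm//.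
  have -> : C * M = b n * ((((n.+1%:R / 2) `^ p^-1)^-1 * (1 - p^-1)^-1) * M).
    rewrite powRM// invfM !mulrA; congr (_ * _ * _).
    by rewrite mulfV ?mul1r// gt_eqF.
  rewrite EFinM lee_pmul2l ?lte_fin//; apply: (average_qbounded _ _ yM).
    by rewrite divr_gt0.
  by move=> k qk; rewrite mulrAC truncn_half.
- move=> x _ k; near=> n.
  rewrite /g -[slice n _]/((b n)^-1 *: spread (q n) x).
  have -> : (b n)^-1 *: spread (q n) x = (b n)^-1 *: spread (q n) x + 0.
    by rewrite addr0.
  rewrite average_linear scalerDr scalerA mulfV ?gt_eqF// scale1r.
  have -> : average (q n) (0 : G * nat -> R) = 0.
    by apply/funext => j; rewrite /average big1 ?mulr0.
  rewrite scaler0 addr0 spreadK// /q truncn_gt0 -ler_pdivrMr//.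
  apply: (@le_trans _ _ n%:R); last by rewrite ler_nat.
  by near: n; exact: nbhs_infty_ger.
Unshelve. all: by end_near. Qed.

Lemma qcompl_supq_ones (G : choiceType) (w : G -> {posnum R}) :
  countable [set: G] -> qcompl (W w) (supq (W (@unit_weight R nat))).
Proof.
move=> /countable_injP[e eI]; apply: qcompl_trans (qcompl_approx w) _.
apply: qcompl_supq.
apply: (@qcompl_injection _ _ _ _ _ (fun t : G * nat => pickle (e t.1, t.2)) _ _ 1).
- move=> [g i] [g' i'] /(pcan_inj pickleK)[+ ->].
  by move=> /eI -> //; rewrite inE.
- by [].
- by move=> i; rewrite mul1r.
Qed.

(** Weights that are powers of two with nonnegative exponent are integers, so
   here the averages reproduce the function exactly. *)
Definition grid_weight (t : nat * nat) : {posnum R} := (2 ^+ t.1)%:pos.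

Lemma qcompl_grid : qcompl (W grid_weight) (W (@unit_weight R nat)).
Proof.
pose q (t : nat * nat) := (2 ^ t.1)%N.
have qE t : (q t)%:R = 1 * (grid_weight t)%:num by rewrite mul1r natrX.
have d0 : 0 < 1 - p^-1 by rewrite subr_gt0 pV_lt1.
apply: (@qcompl_trans _ _ _ _ _ (W (@unit_weight R ((nat * nat) * nat)%type))).
  exists (spread q), (average q); split.
  - split=> [a x y _ _|]; first exact: spread_linear.
    exists (1 `^ p^-1); first exact: powR_ge0.
    by apply: spread_qbounded => // t; rewrite qE.
  - split=> [a x y _ _|]; first exact: average_linear.
    exists ((1 `^ p^-1)^-1 * (1 - p^-1)^-1).
      by rewrite mulr_ge0// invr_ge0 ?powR_ge0 ?ltW.
    by apply: average_qbounded => // t _; rewrite qE.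
  - by move=> x _; apply/funext => t; rewrite spreadK// expn_gt0.
apply: (@qcompl_injection _ _ _ _ _ pickle _ _ 1) => //.
by move=> i; rewrite mul1r.
Qed.

(** By induction, the exponents below the largest one [m] contribute at most
   [2 * 2 ^ (m - 1)]. *)
Lemma sum_distinct_pow2 (s : seq int) (T : R) : uniq s -> 0 <= T ->
  {in s, forall e, 2 ^ e <= T} -> \sum_(e <- s) 2 ^ e <= 2 * T.
Proof.
move: {2}(size s) (erefl (size s)) => n; elim: n s T => [|n IH] s T sn us T0 sT.
  by rewrite (size0nil sn) big_nil mulr_ge0.
have [|m ms mmax] := @seq_argmin _ int _ (fun e => - e) s.
  by rewrite -size_eq0 sn.
rewrite (perm_big _ (perm_to_rem ms)) big_cons.
apply: (@le_trans _ _ (2 ^ m + 2 * 2 ^ (m - 1))).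
  rewrite lerD2l; apply: IH; rewrite ?rem_uniq ?size_rem ?sn ?exprz_ge0//.
  move=> e; rewrite mem_rem_uniq// !inE => /andP[em /mmax]; rewrite lerN2 => le_em.
  have lt_em : e < m by rewrite lt_neqAle em.
  by rewrite ler_eXz2l ?ltr1n// -ltzD1 subrK.
have -> : 2 * 2 ^ (m - 1) = 2 ^ m :> R.
  by rewrite -[X in X * _]expr1z -expfzDr// addrC subrK.
by have := sT m ms; lra.
Qed.

Lemma sum_by_label (A : Type) (B : eqType) (s : seq A) (l : A -> B) (F : B -> R) :
  \sum_(t <- s) F (l t) = \sum_(b <- undup (map l s)) F b *+ count (fun t => l t == b) s.
Proof.
rewrite -(big_map l xpredT) -big_undup_iterop_count.
by apply: eq_bigr => b _; rewrite count_map.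
Qed.

(** The finite set [b] of excluded exponents allows pieces to be chosen one
   after another at scales not covered by the earlier ones. *)
Definition rich (G : Type) (w : G -> {posnum R}) :=
  forall n (b : seq int), exists k (h : nat -> G), [/\ k \notin b,
    {in gtn n &, injective h} & forall i, (i < n)%N -> (w (h i))%:num = 2 ^ k].

Lemma rich_grid : rich grid_weight.
Proof.
move=> n b; pose m := (\max_(e <- b) `|e|%N).+1.
exists (m : int), (fun i => (m, i)); split=> [|i j _ _ []//|//].
apply/negP => /(leq_bigmax_seq (F := absz)) => /(_ xpredT isT).
by rewrite absz_nat ltnn.
Qed.

End Embeddings.

(** * Copies of finite pieces at pairwise separated scales *)

Section Blocks.
Context {R : realType} (p : R) (p1 : 1 < p).
Local Notation W := (weak_quasinorm p1).
Context (G : choiceType) (w : G -> {posnum R}).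

(** The exponents are chosen greedily, so that no translate of
   [iota 0 (N j).+1] meets an earlier one; [used j] collects the integers
   covered by the translates before [j]. *)
Lemma rich_blocks (N : nat -> nat) : rich w -> exists (K : nat -> int) (h : nat -> nat -> G),
  [/\ forall j, {in gtn (N j) &, injective (h j)},
      forall j i, (i < N j)%N -> (w (h j i))%:num = 2 ^ K j &
      forall i j (a b : nat), (a <= N i)%N -> (b <= N j)%N ->
        K i + a%:Z = K j + b%:Z -> i = j].
Proof.
move=> wr.
have /choice[c cP] : forall nb : nat * seq int, exists kh : int * (nat -> G),
    [/\ kh.1 \notin nb.2, {in gtn nb.1 &, injective kh.2} &
      forall i, (i < nb.1)%N -> (w (kh.2 i))%:num = 2 ^ kh.1].
  by move=> [n b]; have [k [h [kb hI hw]]] := wr n b; exists (k, h).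
pose avoid j (b : seq int) := [seq e - a%:Z | e <- b, a <- iota 0 (N j).+1].
pose used := fix used j : seq int := if j is i.+1 then
  used i ++ [seq (c (N i, avoid i (used i))).1 + a%:Z | a <- iota 0 (N i).+1]
  else [::].
pose k j := c (N j, avoid j (used j)).
have usedS i j : (i < j)%N -> forall a : nat, (a <= N i)%N -> (k i).1 + a%:Z \in used j.
  elim: j => // j IH; rewrite ltnS leq_eqVlt => ij a aN.
  rewrite -[used j.+1]/(used j ++ [seq (k j).1 + a%:Z | a : nat <- iota 0 (N j).+1]).
  rewrite mem_cat; case/predU1P: ij => [ij|ij]; last by rewrite IH.
  by rewrite -ij; apply/orP; right; apply/mapP; exists a => //; rewrite mem_iota.
have sep i j : (i < j)%N -> forall a b : nat, (a <= N i)%N -> (b <= N j)%N ->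
    (k i).1 + a%:Z <> (k j).1 + b%:Z.
  move=> ij a b aN bN e; have [/negP] := cP (N j, avoid j (used j)); case=> /=.
  rewrite -/(k j) (_ : (k j).1 = (k i).1 + a%:Z - b%:Z); last by rewrite e addrK.
  apply/allpairsP; exists ((k i).1 + a%:Z, b); split=> //; first exact: usedS.
  by rewrite mem_iota.
exists (fun j => (k j).1), (fun j => (k j).2); split=> [j|j i iN|i j a b aN bN e].
- by have [] := cP (N j, avoid j (used j)).
- by have [_ _] := cP (N j, avoid j (used j)); exact.
- have [ij|ji|//] := ltngtP i j; first by case: (sep i j ij a b).
  by case: (sep j i ji b a).
Qed.

(** Separated blocks do not interact: the points where a function of
   coordinatewise norm [M] exceeds [c] contribute, block by block, masses
   comparable to distinct powers of two below [T = (M / c) `^ p], hence a total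
   mass of at most [4 * T]. The truncations to the first [n] coordinates
   then recover the whole sequence in the limit. *)
Lemma qcompl_rich :
  rich w -> qcompl (supq (W (@unit_weight R nat))) (W w).
Proof.
move=> wr; pose N j := if unpickle j is Some mn then (mn : nat * nat).2 else 0%N.
have [K' [h' [hI hw sep]]] := rich_blocks N wr.
(* Block [(m, n)] receives the first [n] coordinates of copy [m]. *)
pose K (a : nat * nat) := K' (pickle a); pose h (a : nat * nat) := h' (pickle a).
have Na (a : nat * nat) : N (pickle a) = a.2 by rewrite /N pickleK.
have {}hI a : {in gtn a.2 &, injective (h a)} by have := hI (pickle a); rewrite Na.
have {}hw a i : (i < a.2)%N -> (w (h a i))%:num = 2 ^ K a.
  by move=> ia; rewrite hw// Na.
have {}sep a b (i j : nat) : (i <= a.2)%N -> (j <= b.2)%N ->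
    K a + i%:Z = K b + j%:Z -> a = b.
  by move=> ia jb /sep; rewrite !Na => /(_ ia jb) /(pcan_inj pickleK).
pose T : choiceType := {t : (nat * nat) * nat | (t.2 < t.1.2)%N}.
pose H (t : T) := h (val t).1 (val t).2.
have HI : injective H.
  move=> t u; rewrite /H => e; apply: val_inj; move: (valP t) (valP u) e.
  case: (val t) (val u) => a i [b j] /= ia jb e.
  have ab : a = b.
    apply: (sep a b 0%N 0%N) => //; rewrite !addr0.
    apply: (@ieexprIz R 2) => //; first by rewrite gt_eqF// ltr1n.
    by rewrite -(hw _ _ ia) -(hw _ _ jb) e.
  by move: jb e; rewrite -ab => ja /hI -> //.
pose beta a : R := (2 ^ K a) `^ p^-1.
have pow0 a : 0 < 2 ^ K a :> R by rewrite exprz_gt0.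
have beta0 a : 0 < beta a by rewrite powR_gt0.
pose f y := extend H (fun t : T => (beta (val t).1)^-1 * y ((val t).1.1, (val t).2)).
pose g n x (mi : nat * nat) : R :=
  if (mi.2 < n)%N then beta (mi.1, n) * x (h (mi.1, n) mi.2) else 0.
have fH y (t : T) : f y (H t) = (beta (val t).1)^-1 * y ((val t).1.1, (val t).2).
  exact: extend_inj.
apply: (@qcompl_of_limit _ _ _ _ _ f g 1) => //.
- by apply: pointwise_closed_supq; exact: weak_pointwise_closed.
- split=> [a x y _ _|].
    rewrite /f -extend_linear; congr extend; apply/funext => t.
    by rewrite !fctE mulrDr; congr (_ + _); exact: mulrCA.
  exists (4 `^ p^-1); first exact: powR_ge0.
  move=> y M /supq_le yM; have M0 := qnorm_le_ge0 (yM 0%N).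
  apply: weak_normI => [|s c us c0 cy]; first by rewrite mulr_ge0// powR_ge0.
  have [|s' ss'] := @seq_preimage _ _ H s.
    move=> k /cy ck; have : f y k != 0.
      by apply: contraTneq ck => ->; rewrite normr0 -ltNge.
    exact: extend_neq0.
  have us' : uniq s' by move: us; rewrite ss' => /map_uniq.
  pose lab (t : T) := (val t).1.
  pose n a := count (fun t => lab t == a) s'.
  pose idx a := [seq (val t).2 | t <- s' & lab t == a].
  have size_idx a : size (idx a) = n a by rewrite size_map size_filter.
  have uidx a : uniq (idx a).
    rewrite map_inj_in_uniq ?filter_uniq// => t u.
    rewrite !mem_filter => /andP[/eqP ta _] /andP[/eqP ua _] tu.
    apply: val_inj; rewrite [val t]surjective_pairing [val u]surjective_pairing.
    by rewrite tu -/(lab t) -/(lab u) ta ua.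
  pose tau := (M / c) `^ p.
  have Mc0 : 0 <= M / c by rewrite divr_ge0// ltW.
  have mass_block a : 2 ^ K a *+ n a <= tau.
    rewrite -[leLHS]mulr_natr -powRV_leP//; last by rewrite mulr_ge0// ltW.
    rewrite ler_pdivlMr// mulrC powRM ?(ltW (pow0 _))// -/(beta a) mulrA.
    have := weak_normE (yM a.1) (uidx a) (c := c * beta a).
    rewrite mass1 size_idx; apply; first by rewrite mulr_ge0// ltW.
    move=> _ /mapP[t + ->]; rewrite mem_filter => /andP[/eqP ta ts].
    have := cy (H t); rewrite ss' map_f// fH => /(_ isT).
    rewrite -/(lab t) ta normrM gtr0_norm ?invr_gt0// mulrC.
    by rewrite ler_pdivlMr.
  have n_le a : (n a <= a.2)%N.
    rewrite -size_idx -[leqRHS](size_iota 0); apply: uniq_leq_size => // i.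
    case/mapP => t + ->; rewrite mem_filter mem_iota add0n => /andP[/eqP <- _].
    exact: (valP t).
  (* [2 ^ e a] is within a factor two of the mass contributed by block [a];
     the [e a] are distinct since they lie in disjoint intervals. *)
  pose e a := K a + (trunc_log 2 (n a))%:Z.
  have n_gt0 a : a \in undup (map lab s') -> (0 < n a)%N.
    rewrite mem_undup => /mapP[t ts ->]; rewrite -has_count.
    by apply/hasP; exists t => //; rewrite eqxx.
  have log_le a : (0 < n a)%N -> (2 ^ trunc_log 2 (n a) <= n a)%N.
    by move=> na; exact: trunc_logP.
  have eE a : 2 ^ e a = 2 ^ K a * (2 ^ trunc_log 2 (n a))%N%:R :> R.
    by rewrite /e expfzDr// natrX.
  have mass_s : mass w s <= 4 * tau.
    rewrite /mass ss' big_map (eq_bigr (fun t => 2 ^ K (lab t))); last first.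
      by move=> t _; rewrite hw// (valP t).
    rewrite (sum_by_label s' lab (fun a => 2 ^ K a)).
    apply: (@le_trans _ _ (\sum_(a <- undup (map lab s')) 2 * 2 ^ e a)).
      rewrite big_seq [leRHS]big_seq; apply: ler_sum => a /n_gt0 na.
      rewrite -[leLHS]mulr_natr eE mulrCA ler_pM2l// -natrM ler_nat -expnS.
      by rewrite ltnW// trunc_log_ltn.
    rewrite -mulr_sumr (_ : 4 = 2 * 2) -?mulrA; last by rewrite -natrM.
    rewrite ler_pM2l// -(big_map e xpredT (fun e => 2 ^ e)).
    apply: sum_distinct_pow2.
    + rewrite map_inj_in_uniq ?undup_uniq// => a b /n_gt0 na /n_gt0 nb.
      apply: sep; apply: leq_trans (n_le _).
        exact: leq_trans (ltnW (ltn_expl _ _)) (log_le _ na).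
      exact: leq_trans (ltnW (ltn_expl _ _)) (log_le _ nb).
    + exact: powR_ge0.
    + move=> _ /mapP[a /n_gt0 na ->]; apply: le_trans (mass_block a).
      by rewrite eE -[leRHS]mulr_natr ler_pM2l// ler_nat log_le.
  apply: (@le_trans _ _ (c * (4 * tau) `^ p^-1)).
    by rewrite ler_pM2l// powRV_le// mass_ge0.
  by rewrite powRM ?powR_ge0// powRVK// mulrCA [c * _]mulrC divfK// gt_eqF.
- move=> n a x y _ _; apply/funext => -[m i]; rewrite /g !fctE /=.
  case: ifP => _; last by rewrite scaler0 addr0.
  by rewrite mulrDr; congr (_ + _); exact: mulrCA.
- move=> n x M xM; rewrite mul1r; apply/supq_le => m.
  have M0 := qnorm_le_ge0 xM.
  apply: weak_normI => // s c us c0 cx.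
  have sn i : i \in s -> (i < n)%N.
    move=> /cx; rewrite /slice /g /=; case: ifP => // _.
    by rewrite normr0 leNgt c0.
  have := @weak_normE _ _ _ _ _ _ _ (map (h (m, n)) s) (c / beta (m, n)) xM.
  have -> : mass w (map (h (m, n)) s) = 2 ^ K (m, n) * (size s)%:R.
    rewrite /mass big_map big_seq (eq_bigr (fun=> 2 ^ K (m, n))).
      by rewrite -big_seq big_const_seq count_predT iter_addr_0 mulr_natr.
    by move=> i /sn ni; exact: (hw (m, n) i ni).
  rewrite powRM ?(ltW (pow0 _))// -/(beta _) mulrA divfK ?gt_eqF// mass1.
  apply.
  + by rewrite map_inj_in_uniq// => i j /sn ni /sn nj; exact: (hI (m, n) i j ni nj).
  + by rewrite divr_ge0// ltW.
  + move=> _ /mapP[i si ->]; have := cx i si.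
    rewrite /slice /g /= sn// normrM gtr0_norm// mulrC.
    by rewrite ler_pdivrMr.
- move=> y _ [m i]; near=> n.
  have ni : (i < n)%N by near: n; exact: nbhs_infty_gt.
  rewrite /g /= ni; pose t : T := exist _ ((m, n), i) ni.
  by rewrite -[h _ _]/(H t) fH /= mulVKf// gt_eqF.
Unshelve. all: by end_near. Qed.

End Blocks.

(** * Bounded levels: the space of bounded sequences *)

Section BoundedLevels.
Context {R : realType} (p : R) (p1 : 1 < p).
Local Notation W := (weak_quasinorm p1).

Lemma sup_norm_le (x : nat -> R) (M : R) :
  (sup_norm x <= M%:E)%E <-> forall n, `|x n| <= M.
Proof.
split=> [xM n|xM]; last by apply: ge_ereal_sup => _ [n _ <-]; rewrite lee_fin.
by rewrite -lee_fin (le_trans (le_sup_norm x n)).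
Qed.

(** When [|x|] is at least [c] on [s] and [|x|] is at most [M * w `^ (- p^-1)],
   all weights on [s] are at most [T = (M / c) `^ p]; with at most [N] points
   for each power of two, [s] then has mass at most [2 * N * T]. So the weak
   norm of [x] is equivalent to the supremum of [|x| * w `^ p^-1]. *)
Lemma qiso_linfty (G : choiceType) (w : G -> {posnum R}) (lev : G -> int) (N : nat) :
  ([set: G] #= [set: nat])%card -> (forall g, (w g)%:num = 2 ^ lev g) ->
  (forall k s, uniq s -> {in s, forall g, lev g = k} -> (size s <= N)%N) ->
  qiso (W w) (@sup_quasinorm R).
Proof.
move=> /setT_bij[e [d [ed de]]] wlev levN.
have b0 g : 0 < (w g)%:num `^ p^-1 by rewrite powR_gt0.
exists (fun x n => (w (d n))%:num `^ p^-1 * x (d n)).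
exists (fun y g => ((w g)%:num `^ p^-1)^-1 * y (e g)); split.
- split=> [a x y _ _|].
    by apply/funext => n; rewrite !fctE mulrDr; congr (_ + _); exact: mulrCA.
  exists 1 => // x M xM; rewrite mul1r; apply/sup_norm_le => n.
  by rewrite normrM gtr0_norm// mulrC; exact: weak_norm_coord.
- split=> [a x y _ _|].
    by apply/funext => n; rewrite !fctE mulrDr; congr (_ + _); exact: mulrCA.
  exists ((2 * N%:R) `^ p^-1); first exact: powR_ge0.
  move=> y M yM; have M0 := qnorm_le_ge0 yM; move/sup_norm_le in yM.
  apply: weak_normI => [|s c us c0 cy]; first by rewrite mulr_ge0// powR_ge0.
  pose T := (M / c) `^ p; have T0 : 0 <= T by exact: powR_ge0.
  have wT g : g \in s -> 2 ^ lev g <= T.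
    move=> /cy; rewrite normrM gtr0_norm ?invr_gt0// ler_pdivlMl// => cg.
    rewrite -wlev -powRV_leP//; last by rewrite divr_ge0// ltW.
    by rewrite ler_pdivlMr// (le_trans cg).
  have mass_s : mass w s <= 2 * N%:R * T.
    rewrite /mass (eq_bigr (fun g => 2 ^ lev g)) => [|g _]; last exact: wlev.
    rewrite (sum_by_label s lev (fun k => 2 ^ k)).
    apply: (@le_trans _ _ (\sum_(k <- undup (map lev s)) N%:R * 2 ^ k)).
      apply: ler_sum => k _; rewrite -[leLHS]mulr_natl ler_pM2r ?exprz_gt0//.
      rewrite ler_nat -size_filter; apply: (levN k); first exact: filter_uniq.
      by move=> g; rewrite mem_filter => /andP[/eqP].
    rewrite -mulr_sumr [2 * _]mulrC -mulrA ler_wpM2l//.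
    apply: sum_distinct_pow2; rewrite ?undup_uniq// => k.
    by rewrite mem_undup => /mapP[g gs ->]; exact: wT.
  apply: (@le_trans _ _ (c * (2 * N%:R * T) `^ p^-1)).
    by rewrite ler_pM2l// powRV_le// mass_ge0.
  rewrite powRM ?mulr_ge0// powRVK ?divr_ge0 ?(ltW c0)//.
  by rewrite mulrCA [c * _]mulrC divfK// gt_eqF.
- by move=> x _; apply/funext => g; rewrite ed mulKf// gt_eqF.
- by move=> y _; apply/funext => n; rewrite de mulVKf// gt_eqF.
Qed.

(** * The unweighted weak space is not complemented in the bounded sequences *)

(** Signs are chosen one at a time, each making the sum of its cross terms with
   the earlier ones nonnegative. *)
Lemma signs (n : nat) (a : nat -> nat -> R) : exists eps : nat -> R,
  (forall i, `|eps i| = 1) /\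
  \sum_(i < n) a i i <= \sum_(i < n) \sum_(j < n) eps i * eps j * a i j.
Proof.
elim: n => [|n [eps [eps1 IH]]].
  by exists (fun=> 1); split=> [i|]; rewrite ?normr1// !big_ord0.
pose T := \sum_(i < n) eps i * (a i n + a n i).
pose sg : R := if 0 <= T then 1 else -1.
have sgT : 0 <= sg * T.
  rewrite /sg; case: ifPn => [|]; first by rewrite mul1r.
  by rewrite -ltNge mulN1r oppr_ge0 => /ltW.
have sg1 : `|sg| = 1 by rewrite /sg; case: ifP; rewrite ?normrN1 ?normr1.
have sgsg : sg * sg = 1 by rewrite /sg; case: ifP; rewrite ?mulr1 ?mulrN1 ?opprK.
exists (fun i => if (i < n)%N then eps i else sg); split=> [i|]; first by case: ifP.
have E (i : 'I_n) : (if (i < n)%N then eps i else sg) = eps i by rewrite ltn_ord.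
rewrite big_ord_recr /= [leRHS]big_ord_recr /= big_ord_recr /= ltnn sgsg mul1r addrA.
rewrite lerD2r; apply: le_trans IH _.
rewrite -[leLHS]addr0.
have -> : \sum_(i < n) \sum_(j < n.+1)
    (if (i < n)%N then eps i else sg) * (if (j < n)%N then eps j else sg) * a i j =
  \sum_(i < n) \sum_(j < n) eps i * eps j * a i j + \sum_(i < n) eps i * sg * a i n.
  rewrite -big_split; apply: eq_bigr => i _; rewrite big_ord_recr /= ltnn E.
  by congr (_ + _); apply: eq_bigr => j _; rewrite E.
rewrite -addrA lerD2l; apply: le_trans sgT _.
rewrite /T mulr_sumr -big_split /= le_eqVlt; apply/predU1l.
by apply: eq_bigr => i _; rewrite E; ring.
Qed.

Lemma ones_bound (x : nat -> R) (S : seq nat) : (forall i, `|x i| <= 1) ->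
  (forall i, i \notin S -> x i = 0) ->
  (W (@unit_weight R nat) x <= ((size S)%:R `^ p^-1)%:E)%E.
Proof.
move=> x1 xS; apply: weak_normI => [|s c us c0 cx]; first exact: powR_ge0.
rewrite mass1; case: s us cx => [|i s] us cx.
  by rewrite powR0 ?mulr0 ?powR_ge0// gt_eqF// pV_gt0.
have c1 : c <= 1 by apply: le_trans (x1 i); apply: cx; rewrite mem_head.
apply: (@le_trans _ _ ((size (i :: s))%:R `^ p^-1)).
  by rewrite ler_piMl// powR_ge0.
rewrite powRV_le// ler_nat uniq_leq_size// => j /cx; apply: contraTT => /xS ->.
by rewrite normr0 -ltNge.
Qed.

(** The vectors [v i] below have supports of bounded overlap, so their signed
   sums are bounded in [l^oo] however many are added. Their images under [g]
   have diagonal coordinates at least [1/2], so some signed sum of [n] images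
   has [n] coordinates of total modulus at least [n / 2]; but any [n]
   coordinates of a function of weak norm [K] have total modulus at most of
   order [K * n `^ (1 - p^-1)]. *)
Lemma ones_not_compl_linfty :
  ~ qcompl (W (@unit_weight R nat)) (@sup_quasinorm R).
Proof.
move=> [f [g [bf bg fg]]].
have [[lf [C C0 fC]] [lg [D D0 gD]]] := (bf, bg).
set L := W _ in bf bg fg lf lg fC gD.
pose e i : nat -> R := fun j => (i == j)%:R.
have eL i : (L (e i) <= 1%:E)%E.
  have := @ones_bound (e i) [:: i]; rewrite powR1; apply=> j.
    by rewrite /e; case: eqP => _; rewrite ?normr1// normr0.
  by rewrite inE eq_sym /e => /negPf ->.
have eF i : e i \in qfinite L by apply/qfiniteP; exists 1.
pose u i := f (e i).
have uC i k : `|u i k| <= C.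
  by have /sup_norm_le := fC _ _ (eL i); rewrite mulr1; exact.
have uF i : u i \in qfinite (@sup_quasinorm R) by exact: (blinear_fin bf).
(* So small that cutting off below [delta] moves images by at most [1/2]. *)
pose delta := (2 * (D + 1))^-1.
have delta0 : 0 < delta by rewrite invr_gt0 mulr_gt0// ltr_wpDl.
have q0 : 0 < 1 - p^-1 by rewrite subr_gt0 pV_lt1.
pose B0 := (C / delta) `^ (1 - p^-1)^-1.
have B00 : 0 <= B0 by exact: powR_ge0.
have overlap k (S : seq nat) : uniq S -> {in S, forall i, delta < `|u i k|} ->
    (size S)%:R <= B0.
  move=> uS Sd; pose x := \sum_(i <- S) Num.sg (u i k) *: e i.
  have fx : f x k = \sum_(i <- S) `|u i k|.
    rewrite /x (qlinear_sum S (fun i => Num.sg (u i k)) lf eF).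
    rewrite fct_sumE; apply: eq_bigr => i _; rewrite [RHS]normrEsg//.
  have xL : (L x <= ((size S)%:R `^ p^-1)%:E)%E.
    have xE j : x j = if j \in S then Num.sg (u j k) else 0.
      rewrite /x fct_sumE; case: ifPn => jS.
        rewrite (bigD1_seq j)//= big1 ?addr0 => [|i ij].
          by rewrite !fctE /e eqxx; exact: mulr1.
        by rewrite !fctE /e (negPf ij); exact: mulr0.
      rewrite big_seq big1// => i iS; rewrite !fctE /e.
      have /negPf -> : i != j by apply: contraNneq jS => <-.
      exact: mulr0.
    apply: ones_bound => j; rewrite xE; last by move=> /negPf ->.
    by case: ifP => _; rewrite ?normr0// normr_sg lern1 leq_b1.
  have /sup_norm_le/(_ k) := fC _ _ xL; rewrite fx ger0_norm ?sumr_ge0// => le1.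
  have le2 : delta * (size S)%:R <= \sum_(i <- S) `|u i k|.
    have -> : delta * (size S)%:R = \sum_(i <- S) delta.
      by rewrite big_const_seq count_predT iter_addr_0 mulr_natr.
    by rewrite big_seq [leRHS]big_seq; apply: ler_sum => i /Sd /ltW.
  have {le1 le2} le3 := le_trans le2 le1.
  have [->//|m0] := posnP (size S).
  have m0' : 0 < (size S)%:R :> R by rewrite ltr0n.
  have : (size S)%:R `^ (1 - p^-1) <= C / delta.
    rewrite ler_pdivlMr// -(ler_pM2r (powR_gt0 p^-1 m0')) mulrAC -powRD; last first.
      by rewrite (gt_eqF m0') implybT.
    by rewrite subrK powRr1 ?(ltW m0')// mulrC.
  move=> le4; rewrite (_ : (size S)%:R = ((size S)%:R `^ (1 - p^-1)) `^ (1 - p^-1)^-1).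
    apply: ge0_ler_powR => //; rewrite ?nnegrE ?powR_ge0//.
      by rewrite invr_ge0 ltW.
    by rewrite divr_ge0// ltW.
  by rewrite -powRrM mulfV ?powRr1 ?ler0n// gt_eqF.
pose v i k := if delta < `|u i k| then u i k else 0.
have vF i : v i \in qfinite (@sup_quasinorm R).
  apply/qfiniteP; exists C => //; apply/sup_norm_le => k; rewrite /v.
  by case: ifP => _; rewrite ?normr0.
have unitE x (M : R) j : (L x <= M%:E)%E -> `|x j| <= M.
  by move=> /(@weak_norm_coord _ _ p1 _ _ _ _ j); rewrite powR1 mulr1.
have diag i : 2^-1 <= g (v i) i.
  have uvd : (sup_norm (u i - v i)%R <= delta%:E)%E.
    apply/sup_norm_le => k; rewrite !fctE /v; case: ltP => [_|//].
      by rewrite subrr normr0 ltW.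
    by rewrite subr0.
  have := unitE _ _ i (gD _ _ uvd); rewrite (qlinearB lg)// fg//.
  have Dd : D * delta <= 2^-1.
    rewrite /delta invfM mulrCA ger_pMr// ler_pdivrMr ?mul1r ?lerDl//.
    by rewrite ltr_wpDl.
  have -> : (e i - g (v i)) i = 1 - g (v i) i by rewrite !fctE /e eqxx.
  move=> /(le_trans (ler_norm _)) /le_trans /(_ Dd); lra.
pose K := (1 - p^-1)^-1 * (D * (C * B0)).
have K0 : 0 <= K by rewrite !mulr_ge0// invr_ge0 ltW.
have key n : n%:R / 2 <= K * n%:R `^ (1 - p^-1).
  have [eps [eps1 epsn]] := signs n (fun i j => g (v j) i).
  pose V : nat -> R := \sum_(j <- iota 0 n) eps j *: v j.
  have gV : g V = \sum_(j <- iota 0 n) eps j *: g (v j).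
    exact: (qlinear_sum _ _ lg vF).
  have VB : (sup_norm V <= (C * B0)%:E)%E.
    apply/sup_norm_le => k; rewrite /V fct_sumE.
    apply: le_trans (ler_norm_sum _ _ _) _.
    apply: (@le_trans _ _ (\sum_(j <- iota 0 n | delta < `|u j k|) C)).
      rewrite [leRHS]big_mkcond; apply: ler_sum => j _.
      rewrite !fctE normrM eps1 mul1r /v; case: ifP => // _.
      by rewrite normr0.
    rewrite -big_filter big_const_seq count_predT iter_addr_0 -mulr_natr.
    rewrite ler_wpM2l//; apply: (overlap k); first by rewrite filter_uniq// iota_uniq.
    by move=> j; rewrite mem_filter => /andP[].
  have := weak_norm_sum p1 (gD _ _ VB) (iota_uniq 0 n); rewrite size_iota.
  apply: le_trans; apply: (@le_trans _ _ (\sum_(i < n) g (v i) i)).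
    apply: (@le_trans _ _ (\sum_(i < n) 2^-1)); last exact: ler_sum.
    by rewrite sumr_const card_ord -[leRHS]mulr_natl.
  apply: le_trans epsn _.
  rewrite -[X in iota 0 X]subn0 -/(index_iota 0 n) big_mkord.
  apply: ler_sum => i _.
  have -> : \sum_(j < n) eps i * eps j * g (v j) i = eps i * g V i.
    rewrite gV fct_sumE -[X in iota 0 X]subn0 -/(index_iota 0 n) big_mkord mulr_sumr.
    by apply: eq_bigr => j _; rewrite !fctE -mulrA.
  by apply: le_trans (ler_norm _) _; rewrite normrM eps1 mul1r.
pose n := (Num.truncn ((2 * K) `^ p)).+1.
have n0 : 0 < n%:R :> R by rewrite ltr0n.
have nE : n%:R = n%:R `^ p^-1 * n%:R `^ (1 - p^-1) :> R.
  rewrite -powRD; last by rewrite (gt_eqF n0) implybT.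
  by rewrite addrC subrK powRr1// ltW.
have := key n; rewrite [X in X / 2]nE mulrAC ler_pM2r ?powR_gt0// => nK.
have : n%:R `^ p^-1 <= 2 * K by lra.
have K20 : 0 <= 2 * K by exact: mulr_ge0.
rewrite powRV_leP// leNgt => /negP; apply.
exact: truncnS_gt.
Qed.

End BoundedLevels.

(** * The classification *)

Section Classification.
Context {R : realType} (p : R) (p1 : 1 < p).
Local Notation W := (weak_quasinorm p1).
Local Notation L := (W (@unit_weight R nat)).

(** The grid [nat * nat] with weights [2 ^ m] links [L] to its sum: it has pieces
   at every scale, and it is complemented in [L] since its weights are
   integers. *)
Lemma ones_supq : qiso L (supq L).
Proof.
apply: decomposition.
  by apply: qcompl_supq_ones; exact: countableP.
apply: (qcompl_trans _ (qcompl_grid p1)).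
apply: qcompl_rich. exact: rich_grid.
Qed.

Lemma uniq_size_counting (G : choiceType) (A : set G) (s : seq G) (n : nat) :
  (counting A <= n%:R%:E :> \bar R)%E -> uniq s -> {in s, forall g, A g} ->
  (size s <= n)%N.
Proof.
rewrite /counting; case: ifPn => [/asboolP finA|_]; last by rewrite leye_eq.
rewrite lee_fin ler_nat => An us sA; apply: leq_trans An.
apply: uniq_leq_size => // g /sA; rewrite in_fset_set//.
by move=> ?; exact/mem_set.
Qed.

Context (G : choiceType) (w : G -> {posnum R}).

Lemma infinite_level_compl (k : int) :
  infinite_set (level w k) -> qcompl L (W w).
Proof.
move=> /infiniteP/card_leP[h].
pose h' (i : nat) : G := val (h (SigSub (mem_setT i))).
apply: (@qcompl_injection _ _ _ _ _ h' _ _ (2 ^ k)) => [i j||i].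
- by move=> /val_inj /inj => /(_ (mem_setT _) (mem_setT _)) /(congr1 val).
- exact: exprz_gt0.
- by rewrite mulr1; exact: (set_valP (h _)).
Qed.

(** If all levels outside [b] had fewer than [n] points, the finitely many
   finite levels in [b] would leave the supremum finite. *)
Lemma finite_levels_rich (g0 : G) :
  (forall k, finite_set (level w k)) ->
  (ereal_sup [set counting (level w n) | n in [set: int]] = +oo :> \bar R)%E ->
  rich w.
Proof.
move=> fin sup_oo n b.
pose S k : seq G := finmap.enum_fset (fset_set (level w k)).
have cS k : counting (level w k) = (size (S k))%:R%:E :> \bar R.
  by rewrite /counting asboolT.
have [[k [kb kn]]|no] := pselect (exists k, k \notin b /\ (n <= size (S k))%N).
  exists k, (nth g0 (S k)); split=> // [i j|i] ni.
    move=> nj /eqP; rewrite nth_uniq ?finmap.fset_uniq ?(leq_trans _ kn)//.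
    by move/eqP.
  have : nth g0 (S k) i \in S k by rewrite mem_nth// (leq_trans ni).
  by rewrite in_fset_set// inE.
pose M := maxn n (\max_(e <- b) size (S e)).
suff : (+oo <= M%:R%:E :> \bar R)%E by [].
rewrite -sup_oo; apply: ge_ereal_sup => _ [k _ <-].
rewrite cS lee_fin ler_nat leq_max; have [kb|kb] := boolP (k \in b).
  by rewrite (leq_bigmax_seq (F := fun e => size (S e)) k)// orbT.
by apply/orP; left; rewrite leqNgt; apply/negP => nk; apply: no; exists k; split=> //; exact: ltnW.
Qed.

(** An infinite level contains a copy of [L] outright, and hence one of its
   sum by [ones_supq]. *)
Lemma qiso_ones :
  countable [set: G] -> infinite_set [set: G] ->
  (ereal_sup [set counting (level w n) | n in [set: int]] = +oo :> \bar R)%E ->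
  qiso (W w) L.
Proof.
move=> cG iG sup_oo; apply: (@qiso_trans _ _ _ _ _ (supq L)); last first.
  exact/qiso_sym/ones_supq.
apply: decomposition; first exact: qcompl_supq_ones.
have [fin|/existsNP[k infk]] := pselect (forall k, finite_set (level w k)).
  have [g0 _] : [set: G] !=set0 by exact: infinite_setN0.
  exact/qcompl_rich/(finite_levels_rich g0).
apply: (qcompl_trans (qiso_compl (qiso_sym ones_supq))).
exact: infinite_level_compl infk.
Qed.

Lemma qiso_bounded :
  countable [set: G] -> infinite_set [set: G] ->
  (forall g, exists n : int, (w g)%:num = 2 ^ n) ->
  (ereal_sup [set counting (level w n) | n in [set: int]] < +oo :> \bar R)%E ->
  qiso (W w) (@sup_quasinorm R).
Proof.
move=> cG iG /choice[lev wlev] sup_fin.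
have cardG : ([set: G] #= [set: nat])%card.
  by apply/card_eqPle; split=> //; exact/infiniteP.
have le_sup k : (counting (level w k) <=
    ereal_sup [set counting (level w n) | n in [set: int]] :> \bar R)%E.
  by apply: ereal_sup_ubound; exists k.
have c0 : (0 <= counting (level w 0) :> \bar R)%E.
  by rewrite /counting; case: ifP; rewrite ?leey// lee_fin.
set S := ereal_sup _ in sup_fin le_sup.
have Sfin : S \is a fin_num by rewrite ge0_fin_numE// (le_trans c0).
pose N := (Num.truncn (fine S)).+1.
apply: (@qiso_linfty R p p1 G w lev N) => // k s us sk.
apply: (@uniq_size_counting G (level w k)) => //; last first.
  by move=> g /sk <-; exact: wlev.
apply: (le_trans (le_sup k)); rewrite -[leLHS]fineK// lee_fin ltW//.
exact: truncnS_gt.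
Qed.

End Classification.

Theorem theorem6 (R : realType) (p : R) (p1 : 1 < p)
    (G : choiceType) (G_countable : countable [set: G])
    (G_infinite : infinite_set [set: G])
    (w : G -> {posnum R})
    (w_modified : forall g, exists n : int, (w g)%:num = 2 ^ n) :
  (isomorphic (weaklp p1 w) (weaklp_nat p1) <->
    ereal_sup [set counting (level w n) | n in [set: int]] = +oo :> \bar R)%E /\
  (isomorphic (weaklp p1 w) (linfty R) <->
    (ereal_sup [set counting (level w n) | n in [set: int]] < +oo :> \bar R)%E).
Proof.
have ones_linfty : ~ (qiso (weak_quasinorm p1 w) (weak_quasinorm p1 (@unit_weight R nat)) /\
    qiso (weak_quasinorm p1 w) (@sup_quasinorm R)).
  move=> [XL Xl]; apply: (@ones_not_compl_linfty R p p1); apply: qiso_compl.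
  exact: (qiso_trans (qiso_sym XL) Xl).
have [sup_fin|] := ltP (ereal_sup [set counting (level w n) | n in [set: int]]) (+oo : \bar R)%E.
  have Xl := qiso_bounded p1 G_countable G_infinite w_modified sup_fin.
  split; split=> //; last 2 first.
  - by move=> sup_oo; rewrite sup_oo ltxx in sup_fin.
  - by move=> _; exact/isomorphicP.
  by move=> /isomorphicP XL; case: ones_linfty.
rewrite leye_eq => /eqP sup_oo.
have XL := qiso_ones p1 G_countable G_infinite sup_oo.
split; split=> //.
- by move=> _; exact/isomorphicP.
- by move=> /isomorphicP Xl; case: ones_linfty.
Qed.
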